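(* Let $a<0<b$ be real numbers, let $c\colon\mathbb R\to[0,\infty)$ be a continuous function such that $\gamma:=\int_{-\infty}^\infty c(x)\,dx<\infty$ and $\lim_{\varepsilon\to0+}\varepsilon^{-1}c(\varepsilon^{-1}x)=0$ for every $x\neq0$, and for $\varepsilon\in(0,1]$ let $A_\varepsilon$ be the operator in $C[a,b]$ given by $A_\varepsilon f=\frac12 f''-c_\varepsilon f$, where $c_\varepsilon(x)=\varepsilon^{-1}c(\varepsilon^{-1}x)$, on the domain $\mathcal D(A_\varepsilon)$ of all twice continuously differentiable functions $f$ on $[a,b]$ with $f''(a)=f''(b)=0$. Let $\mathcal D(A)\subset C[a,b]$ be composed of those functions $f \in C[a,b]$ that are twice continuously differentiable in each of the subintervals $[a,0]$ and $[0,b]$ separately (with one-sided derivatives at the ends) and such that $$f''(a)=f''(b)=0,\qquad f''(0+)=f''(0-),\qquad f'(0+)-f'(0-)=2\gamma f(0).$$ Then the operator $A$ defined on $\mathcal D(A)$ by $Af=\frac12 f''$ is a Feller generator. Moreover, $$\lim_{\varepsilon\to0+}e^{tA_\varepsilon}f=e^{tA}f,\qquad t\ge0,\ f\in C[a,b],$$ in the norm of $C[a,b]$, and the limit is uniform with respect to $t$ in finite intervals.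
   Context: $C[a,b]$ is the Banach space of real continuous functions on $[a,b]$ with the maximum norm. A Feller semigroup in $C[a,b]$ is a strongly continuous semigroup of positive contraction operators (not necessarily preserving the constant function $1$); a Feller generator is the generator of a Feller semigroup. For a generator $G$, $(e^{tG})_{t\ge0}$ denotes the semigroup it generates. Derivatives at the ends of an interval are one-sided. For $f\in\mathcal D(A)$, the function $f''$ is understood at $x=0$ as the common value $f''(0+)=f''(0-)$, so that $Af\in C[a,b]$. Each operator $A_\varepsilon$, $\varepsilon\in(0,1]$, is a Feller generator. *)

(* Defs.v *)
From Stdlib Require Import Reals Lra ClassicalEpsilon.
From Stdlib Require Import FunctionalExtensionality PropExtensionality ProofIrrelevance.
From Coquelicot Require Import Coquelicot.

Open Scope R_scope.

Definition Icc (a b : R) : R -> Prop := fun x => a <= x <= b.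

(** * The Banach space C[a,b]

    A function on [a,b] is represented by its extension by zero to [R], so that
    Leibniz equality is equality on [a,b].  Continuity is that of the
    restriction to [a,b]: limits are taken along points of [a,b] only. *)
Record Cont (a b : R) : Type := mkC {
  cfun :> R -> R;
  cfun_cont : continuous_on (Icc a b) cfun;
  cfun_out : forall x, ~ Icc a b x -> cfun x = 0 }.

Arguments mkC {a b}.
Arguments cfun {a b}.
Arguments cfun_cont {a b}.
Arguments cfun_out {a b}.

Section ContinuousFunctions.
Context {a b : R}.

Lemma C_ext (f g : Cont a b) : (forall x, Icc a b x -> f x = g x) -> f = g.
Proof.
intros H.
assert (E : cfun f = cfun g).
{ apply functional_extensionality; intros x.
  destruct (excluded_middle_informative (Icc a b x)) as [h|h]; [now apply H|].
  now rewrite !cfun_out. }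
destruct f as [f cf of], g as [g cg og]; simpl in E; subst g.
f_equal; apply proof_irrelevance.
Qed.

Lemma C_plus_cont (f g : Cont a b) : continuous_on (Icc a b) (fun x => f x + g x).
Proof.
intros x Hx.
apply (filterlim_comp_2 (G := locally (f x)) (H := locally (g x))).
- now apply cfun_cont.
- now apply cfun_cont.
- apply (@filterlim_plus R_AbsRing R_NormedModule).
Qed.

Lemma C_scal_cont (k : R) (f : Cont a b) : continuous_on (Icc a b) (fun x => k * f x).
Proof.
intros x Hx.
apply (filterlim_comp _ _ _ f (fun y => k * y) _ (locally (f x))).
- now apply cfun_cont.
- apply (@filterlim_scal_r R_AbsRing R_NormedModule).
Qed.

Lemma C_zero_cont : continuous_on (Icc a b) (fun _ => 0).
Proof. intros x Hx; apply filterlim_const. Qed.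

Definition C_zero : Cont a b := mkC (fun _ => 0) C_zero_cont (fun _ _ => eq_refl).

Definition C_plus (f g : Cont a b) : Cont a b.
Proof.
refine (mkC (fun x => f x + g x) (C_plus_cont f g) _).
abstract (intros x Hx; rewrite !cfun_out by assumption; ring).
Defined.

Definition C_scal (k : R) (f : Cont a b) : Cont a b.
Proof.
refine (mkC (fun x => k * f x) (C_scal_cont k f) _).
abstract (intros x Hx; rewrite !cfun_out by assumption; ring).
Defined.

Definition C_opp (f : Cont a b) : Cont a b := C_scal (-1) f.

(* The supremum is attained when [a <= b]; see [C_norm_max]. *)
Definition C_norm (f : Cont a b) : R :=
  real (Lub_Rbar (fun r => exists x, Icc a b x /\ r = Rabs (f x))).

Lemma C_norm_spec (f : Cont a b) : a <= b ->
  exists x0, Icc a b x0 /\ C_norm f = Rabs (f x0) /\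
    forall x, Icc a b x -> Rabs (f x) <= Rabs (f x0).
Proof.
intros Hab.
pose (cl := fun x => Rmax a (Rmin b x)).
assert (clI : forall x, Icc a b (cl x)).
{ intros x; unfold cl, Icc, Rmax, Rmin.
  repeat destruct Rle_dec; lra. }
assert (clid : forall x, Icc a b x -> cl x = x).
{ intros x; unfold cl, Icc, Rmax, Rmin.
  repeat destruct Rle_dec; lra. }
assert (cllip : forall x y, Rabs (cl y - cl x) <= Rabs (y - x)).
{ intros x y; unfold cl, Rmax, Rmin, Rabs.
  repeat destruct Rle_dec; repeat destruct Rcase_abs; lra. }
destruct (continuity_ab_maj (fun x => Rabs (f (cl x))) a b Hab) as [x0 [Hm Hx0]].
{ intros x Hx. apply continuity_pt_filterlim.
  apply (filterlim_comp _ _ _ (fun x => f (cl x)) Rabs _ (locally (f (cl x)))).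
  2: apply (@filterlim_norm R_AbsRing R_NormedModule).
  apply (filterlim_comp _ _ _ cl f _ (within (Icc a b) (locally (cl x)))).
  2: now apply cfun_cont.
  intros P [d Hd]. exists d. intros y Hy. apply Hd; [|apply clI].
  apply Rle_lt_trans with (2 := Hy). apply cllip. }
assert (Hmax : forall x, Icc a b x -> Rabs (f x) <= Rabs (f x0)).
{ intros x Hx. generalize (Hm x Hx). now rewrite !clid. }
exists x0; split; [exact Hx0|split; [|exact Hmax]].
unfold C_norm.
rewrite (is_lub_Rbar_unique _ (Finite (Rabs (f x0)))); [reflexivity|].
split.
- intros r [x [Hx ->]]. now apply Hmax.
- intros M HM. apply HM. now exists x0.
Qed.

Lemma C_norm_empty (f : Cont a b) : b < a -> C_norm f = 0.
Proof.
intros Hab; unfold C_norm.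
rewrite (is_lub_Rbar_unique _ m_infty); [reflexivity|].
split.
- intros r [x [Hx _]]. unfold Icc in Hx; lra.
- intros M _; now destruct M.
Qed.

Lemma C_norm_max (f : Cont a b) : a <= b ->
  exists x0, Icc a b x0 /\ C_norm f = Rabs (f x0).
Proof.
intros Hab; destruct (C_norm_spec f Hab) as [x0 [H1 [H2 _]]]; now exists x0.
Qed.

Lemma C_norm_ub (f : Cont a b) (x : R) : Rabs (f x) <= C_norm f.
Proof.
destruct (Rle_lt_dec a b) as [Hab|Hab].
- destruct (C_norm_spec f Hab) as [x0 [H1 [H2 H3]]]; rewrite H2.
  destruct (excluded_middle_informative (Icc a b x)) as [h|h]; [now apply H3|].
  rewrite (cfun_out f x h), Rabs_R0; apply Rabs_pos.
- rewrite C_norm_empty by assumption.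
  rewrite cfun_out by (unfold Icc; lra). rewrite Rabs_R0; lra.
Qed.

Lemma C_norm_le (f : Cont a b) (M : R) : 0 <= M ->
  (forall x, Icc a b x -> Rabs (f x) <= M) -> C_norm f <= M.
Proof.
intros HM H.
destruct (Rle_lt_dec a b) as [Hab|Hab].
- destruct (C_norm_max f Hab) as [x0 [H1 ->]]; now apply H.
- now rewrite C_norm_empty.
Qed.

Lemma C_norm_pos (f : Cont a b) : 0 <= C_norm f.
Proof. apply Rle_trans with (2 := C_norm_ub f 0); apply Rabs_pos. Qed.

Definition C_AbelianMonoid_mixin : AbelianMonoid.mixin_of (Cont a b).
Proof.
apply (AbelianMonoid.Mixin (Cont a b) C_plus C_zero);
  abstract (intros; apply C_ext; intros; simpl; ring).
Defined.

Canonical C_AbelianMonoid :=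
  AbelianMonoid.Pack (Cont a b) C_AbelianMonoid_mixin (Cont a b).

Definition C_AbelianGroup_mixin : AbelianGroup.mixin_of C_AbelianMonoid.
Proof.
apply (AbelianGroup.Mixin C_AbelianMonoid C_opp).
abstract (intros f; apply C_ext; intros; simpl; ring).
Defined.

Canonical C_AbelianGroup :=
  AbelianGroup.Pack (Cont a b)
    (AbelianGroup.Class (Cont a b) C_AbelianMonoid_mixin C_AbelianGroup_mixin) (Cont a b).

Definition C_ModuleSpace_mixin : ModuleSpace.mixin_of R_Ring C_AbelianGroup.
Proof.
apply (ModuleSpace.Mixin R_Ring C_AbelianGroup C_scal);
  abstract (intros; apply C_ext; intros; simpl;
            unfold mult, one, plus; simpl; ring).
Defined.

Canonical C_ModuleSpace :=
  ModuleSpace.Pack R_Ring (Cont a b)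
    (ModuleSpace.Class R_Ring (Cont a b) (AbelianGroup.class C_AbelianGroup)
       C_ModuleSpace_mixin) (Cont a b).

Definition C_ball (f : Cont a b) (e : R) (g : Cont a b) : Prop :=
  C_norm (minus g f) < e.

Lemma minusE (f g : Cont a b) (x : R) : minus f g x = f x - g x.
Proof. unfold minus; simpl; ring. Qed.

Lemma C_norm_plus (f g : Cont a b) : C_norm (C_plus f g) <= C_norm f + C_norm g.
Proof.
apply C_norm_le.
- generalize (C_norm_pos f) (C_norm_pos g); lra.
- intros x _; simpl.
  generalize (Rabs_triang (f x) (g x)) (C_norm_ub f x) (C_norm_ub g x); lra.
Qed.

Lemma C_norm_scal (k : R) (f : Cont a b) : C_norm (C_scal k f) <= Rabs k * C_norm f.
Proof.
apply C_norm_le.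
- apply Rmult_le_pos; [apply Rabs_pos|apply C_norm_pos].
- intros x _; simpl; rewrite Rabs_mult.
  apply Rmult_le_compat_l; [apply Rabs_pos|apply C_norm_ub].
Qed.

Lemma C_norm_eq0 (f : Cont a b) : C_norm f = 0 -> f = zero.
Proof.
intros H; apply C_ext; intros x _; simpl.
generalize (C_norm_ub f x) (Rabs_pos (f x)); rewrite H; intros.
apply Rabs_eq_0; lra.
Qed.

Definition C_UniformSpace_mixin : UniformSpace.mixin_of (Cont a b).
Proof.
apply (UniformSpace.Mixin (Cont a b) C_zero C_ball).
- abstract (intros f e; unfold C_ball; apply Rle_lt_trans with (2 := cond_pos e);
    apply C_norm_le; [lra|]; intros x _; rewrite minusE, Rminus_diag, Rabs_R0; lra).
- abstract (intros f g e; unfold C_ball; apply Rle_lt_trans;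
    apply C_norm_le; [apply C_norm_pos|]; intros x _;
    rewrite minusE, Rabs_minus_sym, <- minusE; apply C_norm_ub).
- abstract (intros f g h e1 e2; unfold C_ball; intros H1 H2;
    apply Rle_lt_trans with (C_norm (minus g f) + C_norm (minus h g)); [|lra];
    replace (minus h f) with (C_plus (minus g f) (minus h g));
    [apply C_norm_plus|apply C_ext; intros x _; simpl; ring]).
Defined.

Canonical C_UniformSpace :=
  UniformSpace.Pack (Cont a b) C_UniformSpace_mixin (Cont a b).

Canonical C_NormedModuleAux :=
  NormedModuleAux.Pack R_AbsRing (Cont a b)
    (NormedModuleAux.Class R_AbsRing (Cont a b)
       (ModuleSpace.class _ C_ModuleSpace) C_UniformSpace_mixin) (Cont a b).

Definition C_NormedModule_mixin :
  NormedModule.mixin_of R_AbsRing C_NormedModuleAux.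
Proof.
apply (NormedModule.Mixin R_AbsRing C_NormedModuleAux C_norm 1).
- exact C_norm_plus.
- exact C_norm_scal.
- intros f g e H; exact H.
- abstract (intros f g e H; rewrite Rmult_1_l; exact H).
- exact C_norm_eq0.
Defined.

Canonical C_NormedModule :=
  NormedModule.Pack R_AbsRing (Cont a b)
    (NormedModule.Class R_AbsRing (Cont a b)
       (NormedModuleAux.class _ C_NormedModuleAux) C_NormedModule_mixin) (Cont a b).

Lemma C_complete (F : (Cont a b -> Prop) -> Prop) : ProperFilter F -> cauchy F ->
  exists f : Cont a b, forall e : posreal, F (ball f e).
Proof.
intros PF HF.
pose (G := fun (x : R) (P : R -> Prop) => F (fun g : Cont a b => P (g x))).
assert (PG : forall x, ProperFilter (G x)).
{ intros x; exact (filtermap_proper_filter _ _ (fun g : Cont a b => g x) F PF). }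
pose (L := fun x => lim (T := R_CompleteSpace) (G x)).
assert (HL : forall x (e : posreal), G x (ball (L x) e)).
{ intros x. apply (complete_cauchy (T := R_CompleteSpace)); [apply PG|].
  intros e; destruct (HF e) as [h Hh]. exists (h x).
  unfold G; apply filter_imp with (2 := Hh). intros g Hg.
  change (Rabs (g x - h x) < e). rewrite <- minusE.
  apply Rle_lt_trans with (2 := Hg). apply C_norm_ub. }
assert (HU : forall e : posreal, F (fun g : Cont a b => forall x, Rabs (g x - L x) <= e)).
{ intros e.
  destruct (HF (mkposreal (e/2) (is_pos_div_2 e))) as [h Hh].
  assert (K : forall x, Rabs (h x - L x) <= e/2).
  { intros x. apply le_epsilon; intros d Hd.
    assert (Hd' : F (fun g : Cont a b => Rabs (g x - L x) < d))
      by exact (HL x (mkposreal d Hd)).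
    destruct (filter_ex _ (filter_and _ _ Hh Hd')) as [g [H1 H2]].
    change (C_norm (minus g h) < e/2) in H1.
    generalize (C_norm_ub (minus g h) x); rewrite minusE; intros H3.
    replace (h x - L x) with (- (g x - h x) + (g x - L x)) by ring.
    apply Rle_trans with (1 := Rabs_triang _ _). rewrite Rabs_Ropp. lra. }
  apply filter_imp with (2 := Hh). intros g H1 x.
  change (C_norm (minus g h) < e/2) in H1.
  generalize (C_norm_ub (minus g h) x) (K x); rewrite minusE; intros H3 H4.
  replace (g x - L x) with ((g x - h x) + (h x - L x)) by ring.
  apply Rle_trans with (1 := Rabs_triang _ _). lra. }
assert (Lout : forall x, ~ Icc a b x -> L x = 0).
{ intros x Hx. apply Rabs_eq_0. apply Rle_antisym; [|apply Rabs_pos].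
  apply le_epsilon; intros d Hd.
  destruct (filter_ex _ (HU (mkposreal d Hd))) as [g Hg].
  specialize (Hg x). rewrite (cfun_out g x Hx) in Hg. simpl in Hg.
  rewrite Rabs_minus_sym, Rminus_0_r in Hg. lra. }
assert (Lcont : continuous_on (Icc a b) L).
{ intros x Hx. apply (filterlim_locally (U := R_UniformSpace)). intros e.
  assert (He : 0 < e/4) by (generalize (cond_pos e); lra).
  destruct (filter_ex _ (HU (mkposreal _ He))) as [g Hg]; simpl in Hg.
  generalize (proj1 (filterlim_locally (U := R_UniformSpace) _ _)
    (cfun_cont g x Hx) (mkposreal _ He)).
  apply filter_imp. intros y Hy.
  change (Rabs (g y - g x) < e/4) in Hy. change (Rabs (L y - L x) < e).
  generalize (Hg x) (Hg y). intros H1 H2.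
  replace (L y - L x) with (- (g y - L y) + ((g y - g x) + (g x - L x))) by ring.
  apply Rle_lt_trans with (1 := Rabs_triang _ _). rewrite Rabs_Ropp.
  generalize (Rabs_triang (g y - g x) (g x - L x)). lra. }
exists (mkC L Lcont Lout). intros e.
assert (He : 0 < e/2) by (generalize (cond_pos e); lra).
apply filter_imp with (2 := HU (mkposreal _ He)). simpl; intros g Hg.
change (C_norm (minus g (mkC L Lcont Lout)) < e).
apply Rle_lt_trans with (e/2); [|lra].
apply C_norm_le; [lra|]. intros x _. rewrite minusE. apply Hg.
Qed.

Definition C_lim (F : (Cont a b -> Prop) -> Prop) : Cont a b :=
  epsilon (inhabits C_zero) (fun f => forall e : posreal, F (ball f e)).

Definition C_CompleteSpace_mixin : CompleteSpace.mixin_of C_UniformSpace.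
Proof.
apply (CompleteSpace.Mixin C_UniformSpace C_lim).
- abstract (intros F PF HF; exact (epsilon_spec (inhabits C_zero) _ (C_complete F PF HF))).
- abstract (intros F1 F2 H12 H21;
    replace F2 with F1 by (apply functional_extensionality; intros P;
      apply propositional_extensionality; split; [apply H21|apply H12]);
    apply close_refl).
Defined.

Canonical C_CompleteSpace :=
  CompleteSpace.Pack (Cont a b)
    (CompleteSpace.Class (Cont a b) C_UniformSpace_mixin C_CompleteSpace_mixin) (Cont a b).

Canonical C_CompleteNormedModule :=
  CompleteNormedModule.Pack R_AbsRing (Cont a b)
    (CompleteNormedModule.Class R_AbsRing (Cont a b)
       (NormedModule.class _ C_NormedModule) C_CompleteSpace_mixin) (Cont a b).

End ContinuousFunctions.

(** * Semigroups and generators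

    A family [T : R -> E -> E] only matters at times [t >= 0]. *)
Record strongly_continuous_semigroup {E : NormedModule R_AbsRing}
    (T : R -> E -> E) : Prop := {
  sg_linear : forall t, 0 <= t -> is_linear (T t);
  sg_zero : forall f, T 0 f = f;
  sg_plus : forall s t f, 0 <= s -> 0 <= t -> T (s + t) f = T s (T t f);
  sg_cont : forall f, filterlim (fun t => T t f) (at_right 0) (locally f) }.

(* Unbounded operators are identified with their graphs. *)
Definition operator (E : NormedModule R_AbsRing) : Type := E -> E -> Prop.

Definition generates {E : NormedModule R_AbsRing} (G : operator E)
    (T : R -> E -> E) : Prop :=
  forall f g, G f g <->
    filterlim (fun t => scal (/ t) (minus (T t f) f)) (at_right 0) (locally g).

Record Feller_semigroup {a b : R} (T : R -> Cont a b -> Cont a b) : Prop := {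
  Feller_sg : strongly_continuous_semigroup T;
  Feller_pos : forall t (f : Cont a b), 0 <= t ->
    (forall x, Icc a b x -> 0 <= f x) -> forall x, Icc a b x -> 0 <= T t f x;
  Feller_contr : forall t (f : Cont a b), 0 <= t -> norm (T t f) <= norm f }.

Definition Feller_generator {a b : R} (G : operator (@C_NormedModule a b)) : Prop :=
  exists T : R -> Cont a b -> Cont a b, Feller_semigroup T /\ generates G T.

(** * The operators *)

(* [f] is twice continuously differentiable on [a,b], with derivatives [f1] and
   [f2].  Difference quotients are taken along points of [a,b], so derivatives
   at the ends are one-sided; values outside [a,b] are irrelevant. *)
Definition C2_on (a b : R) (f f1 f2 : R -> R) : Prop :=
  (forall x, Icc a b x -> D_in f f1 (Icc a b) x) /\
  (forall x, Icc a b x -> D_in f1 f2 (Icc a b) x) /\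
  continuous_on (Icc a b) f2.

Definition rescaled (c : R -> R) (eps x : R) : R := / eps * c (/ eps * x).

Definition A_eps (a b : R) (c : R -> R) (eps : R) : operator (@C_NormedModule a b) :=
  fun f g => exists f1 f2,
    C2_on a b f f1 f2 /\ f2 a = 0 /\ f2 b = 0 /\
    forall x, Icc a b x -> g x = / 2 * f2 x - rescaled c eps x * f x.

(* [l1], [l2] and [r1], [r2] are the derivatives of [f] on [a,0] and [0,b]. *)
Definition A_lim (a b gamma : R) : operator (@C_NormedModule a b) :=
  fun f g => exists l1 l2 r1 r2,
    C2_on a 0 f l1 l2 /\ C2_on 0 b f r1 r2 /\
    l2 a = 0 /\ r2 b = 0 /\ r2 0 = l2 0 /\ r1 0 - l1 0 = 2 * gamma * f 0 /\
    (forall x, Icc a 0 x -> g x = / 2 * l2 x) /\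
    (forall x, Icc 0 b x -> g x = / 2 * r2 x).

(* Main.v *)
Require Import Defs.
From Stdlib Require Import Reals Lra Lia ClassicalEpsilon.
From Coquelicot Require Import Coquelicot.
Open Scope R_scope.

(** The resolvents [(I - h A)^-1] of the limit operator are explicit, and with the
    positive minimum principle they are positive contractions.  On [D(A^2)] two implicit
    Euler steps of lengths [s] and [t] differ from one step of length [s + t] by
    [O((s + t)^2)]; hence the dyadic Euler schemes converge, and the limit is a Feller
    semigroup generated by [A].

    For the convergence, one step of any contraction semigroup agrees with an Euler step
    up to [O(h^2)] on [D(A^2)], so it is enough to find, for each [f] in [D(A)], functions
    [f_eps] in [D(A_eps)] with [f_eps -> f] and [A_eps f_eps -> A f].  Off the origin [f]
    is [f(0) + s x] plus a second primitive of [f''], with a kink at 0.  Replacing the kink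
    by [2 f(0)] times a second primitive of [c_eps] gives [W] with
    [A_eps W = f''/2 - c_eps (W - f(0))]; since [W - f(0) = O(x)] while [x c_eps(x)] is
    bounded and has small integral, one Picard correction makes the error vanish. *)

(** * Linear contractions of C[a,b] *)

Section Semigroups.
Context {a b : R}.
Implicit Types f g u v w z : Cont a b.

(** An element of D(A) with a kink at 0 lies in no D(A_eps), so A_eps can be tested only on nearby
    vectors, and how small eps must be depends on the vector. Hence the order of choices: f in
    D(A^2), then the Euler step h, then eps, small enough for the finitely many Euler iterates up to
    the time horizon. Implicit steps suit this: resolvents are contractions commuting with A, so
    membership in D(A^2) and the bound on A^2 f survive all iterations. Vector-valued integrals are
    replaced by sums over small steps. In the approximation of D(A), gamma splits into the masses of
    c on the two half-lines, and the left mass shifts the slope of W. Near 0 the residual c_eps (W -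
    f(0)) is a product of factors of orders 1/eps and eps: it is bounded, but small only in the
    mean. A correction having it as second derivative still has a small first derivative. The decay
    of |z| c(z) behind this is the pointwise limit hypothesis read at x = 1 and x = -1. *)

Lemma norm_bound f x : - norm f <= f x <= norm f.
Proof.
generalize (C_norm_ub f x); change (C_norm f) with (norm f).
unfold Rabs; destruct Rcase_abs; lra.
Qed.

Lemma norm_le_intro f M : 0 <= M ->
  (forall x, Icc a b x -> - M <= f x <= M) -> norm f <= M.
Proof.
intros HM H; apply C_norm_le; [exact HM|]; intros x Hx; apply Rabs_le, H, Hx.
Qed.

Lemma norm_pos f : 0 <= norm f.
Proof. apply C_norm_pos. Qed.

End Semigroups.

(* Matching up to conversion: [minus], [plus] and [scal] on [Cont a b] may come
   from any of its algebraic structures. *)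
Ltac pointwise := repeat match goal with
  | |- context [@cfun ?a ?b (@minus ?G ?f ?g) ?x] =>
      change (@cfun a b (@minus G f g) x) with (@cfun a b f x + -1 * @cfun a b g x)
  | |- context [@cfun ?a ?b (@plus ?G ?f ?g) ?x] =>
      change (@cfun a b (@plus G f g) x) with (@cfun a b f x + @cfun a b g x)
  | |- context [@cfun ?a ?b (@scal ?K ?G ?k ?f) ?x] =>
      change (@cfun a b (@scal K G k f) x) with (k * @cfun a b f x)
  | |- context [@cfun ?a ?b (@zero ?G) ?x] =>
      change (@cfun a b (@zero G) x) with 0
  | |- context [@cfun ?a ?b C_zero ?x] => change (@cfun a b C_zero x) with 0
  end.

Ltac cont_eq := apply C_ext; intros ? ?; pointwise; ring.

Ltac cont_eq_from H := let y := fresh "y" in let Hy := fresh in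
  apply C_ext; intros y Hy; generalize (f_equal (fun k => cfun k y) H);
  cbv beta; pointwise; let E := fresh in intros E; nra.

(* Bounds the norm of a linear combination through the norms of the listed vectors. *)
Tactic Notation "by_norms" constr(l) :=
  apply norm_le_intro; [|let x := fresh "x" in intros x _; pointwise;
    let rec go l := lazymatch l with
      | pair ?l' ?v => go l'; generalize (norm_bound v x); pointwise
      | ?v => generalize (norm_bound v x); pointwise
      end in go l].

Record linear_contraction {a b : R} (F : Cont a b -> Cont a b) : Prop := {
  lc_plus : forall f g : Cont a b, F (plus f g) = plus (F f) (F g);
  lc_scal : forall k (f : Cont a b), F (scal k f) = scal k (F f);
  lc_norm : forall f : Cont a b, norm (F f) <= norm f }.

Arguments lc_plus {a b F}.
Arguments lc_scal {a b F}.
Arguments lc_norm {a b F}.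

Section Contractions.
Context {a b : R}.
Implicit Types f g u v w z : Cont a b.
Implicit Types F G : Cont a b -> Cont a b.

Lemma lc_minus F f g : linear_contraction F -> F (minus f g) = minus (F f) (F g).
Proof.
intros HF.
replace (minus f g) with (plus f (scal (-1) g)) by cont_eq.
rewrite (lc_plus HF), (lc_scal HF); cont_eq.
Qed.

Lemma norm_le_subst f g M : f = g -> norm g <= M -> norm f <= M.
Proof. now intros ->. Qed.

Lemma lc_dist F f g : linear_contraction F ->
  norm (minus (F f) (F g)) <= norm (minus f g).
Proof. intros HF; rewrite <- lc_minus by exact HF; apply (lc_norm HF). Qed.

Lemma lc_id : linear_contraction (fun f : Cont a b => f).
Proof. split; intros; auto; lra. Qed.

Lemma lc_comp F G : linear_contraction F -> linear_contraction G ->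
  linear_contraction (fun f => F (G f)).
Proof.
intros HF HG; split; intros.
- now rewrite (lc_plus HG), (lc_plus HF).
- now rewrite (lc_scal HG), (lc_scal HF).
- apply Rle_trans with (1 := lc_norm HF _), (lc_norm HG).
Qed.

Lemma lc_iter F n : linear_contraction F -> linear_contraction (Nat.iter n F).
Proof.
intros HF; induction n as [|n IH]; [apply lc_id|].
exact (lc_comp _ _ HF IH).
Qed.

Lemma norm_minus_sym f g : norm (minus f g) = norm (minus g f).
Proof.
apply Rle_antisym.
- by_norms (minus g f); [apply norm_pos|lra].
- by_norms (minus f g); [apply norm_pos|lra].
Qed.

Lemma norm_minus_trans f g u :
  norm (minus f u) <= norm (minus f g) + norm (minus g u).
Proof.
generalize (norm_pos (minus f g)) (norm_pos (minus g u)); intros.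
by_norms (minus f g, minus g u); lra.
Qed.

Lemma norm_scal_le k f : 0 <= k -> norm (scal k f) <= k * norm f.
Proof.
intros Hk; apply Rle_trans with (1 := C_norm_scal k f).
rewrite (Rabs_pos_eq k Hk); apply Rle_refl.
Qed.

Lemma norm_minus_diag f : norm (minus f f) = 0.
Proof.
apply Rle_antisym; [|apply norm_pos].
apply norm_le_intro; [lra|]; intros; pointwise; lra.
Qed.

Lemma norm_minus_eq f g : norm (minus f g) <= 0 -> f = g.
Proof.
intros H; apply C_ext; intros x _.
generalize (norm_bound (minus f g) x); pointwise; lra.
Qed.

Lemma norm_minus_small_eq f g : (forall e, 0 < e -> norm (minus f g) <= e) -> f = g.
Proof.
intros H; apply norm_minus_eq, le_epsilon; intros e He; rewrite Rplus_0_l; auto.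
Qed.

(** Telescoping: one more step adds a one-step defect, and [F] does not enlarge the error made so
    far. Defects are measured along the orbit of [G] alone, which in the applications stays in
    D(A^2). *)
Lemma iter_close F G n f M : linear_contraction F ->
  (forall k, (k < n)%nat ->
     norm (minus (F (Nat.iter k G f)) (G (Nat.iter k G f))) <= M) ->
  norm (minus (Nat.iter n F f) (Nat.iter n G f)) <= INR n * M.
Proof.
intros HF; induction n as [|n IH]; intros H.
- simpl; rewrite norm_minus_diag; lra.
- rewrite S_INR; simpl.
  assert (H1 := lc_dist F (Nat.iter n F f) (Nat.iter n G f) HF).
  assert (H2 := norm_minus_trans (F (Nat.iter n F f)) (F (Nat.iter n G f))
    (G (Nat.iter n G f))).
  assert (H3 := H n (Nat.lt_succ_diag_r n)).
  assert (H4 : norm (minus (Nat.iter n F f) (Nat.iter n G f)) <= INR n * M)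
    by (apply IH; intros k Hk; apply H; lia).
  lra.
Qed.

Lemma filterlim_at_right_norm (F : R -> Cont a b) g :
  filterlim F (at_right 0) (locally g) <->
  forall e, 0 < e -> exists d, 0 < d /\ forall t, 0 < t < d -> norm (minus (F t) g) < e.
Proof.
split; intros H.
- intros e He.
  destruct (H (ball g (mkposreal e He))) as [d Hd].
  { now exists (mkposreal e He). }
  exists d; split; [apply cond_pos|]; intros t Ht.
  apply Hd; [|lra].
  change (Rabs (t - 0) < d); rewrite Rabs_pos_eq; lra.
- intros P [e He].
  destruct (H e (cond_pos e)) as [d [Hd Ht]].
  exists (mkposreal d Hd); intros t Ht0 Ht1.
  apply He, Ht; split; [lra|].
  change (Rabs (t - 0) < d) in Ht0; rewrite Rabs_pos_eq in Ht0; lra.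
Qed.

Lemma Cont_seq_complete (U : nat -> Cont a b) :
  (forall e, 0 < e -> exists N, forall m n, (N <= m)%nat -> (N <= n)%nat ->
     norm (minus (U m) (U n)) <= e) ->
  exists f, forall e, 0 < e -> exists N, forall n, (N <= n)%nat ->
    norm (minus (U n) f) <= e.
Proof.
intros H.
destruct (C_complete (filtermap U eventually) _) as [f Hf].
- intros e.
  destruct (H (e / 2)) as [N HN]; [generalize (cond_pos e); lra|].
  exists (U N), N; intros n Hn.
  change (norm (minus (U n) (U N)) < e).
  generalize (HN n N Hn (Nat.le_refl N)) (cond_pos e); lra.
- exists f; intros e He.
  destruct (Hf (mkposreal e He)) as [N HN]; exists N; intros n Hn.
  apply Rlt_le, (HN n Hn).
Qed.

End Contractions.

(** * Resolvents and the implicit Euler scheme *)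

(** [norm f - f] is nonnegative, so a point where its absolute value is largest is a minimum point
    of [f]. The constant is cut off outside [a,b] because elements of [Cont a b] vanish there. *)
Lemma Cont_min_attained {a b : R} (f : Cont a b) : a <= b ->
  exists x0, Icc a b x0 /\ forall x, Icc a b x -> f x0 <= f x.
Proof.
intros Hab; set (M := norm f).
assert (C1 : continuous_on (Icc a b)
  (fun x => if excluded_middle_informative (Icc a b x) then M else 0)).
{ apply (continuous_on_ext (Icc a b) (fun _ => M)).
  - intros x Hx; destruct excluded_middle_informative; tauto.
  - intros x Hx; apply filterlim_const. }
assert (C0 : forall x, ~ Icc a b x ->
  (if excluded_middle_informative (Icc a b x) then M else 0) = 0).
{ intros x Hx; destruct excluded_middle_informative; tauto. }
pose (one_M := mkC _ C1 C0).
destruct (C_norm_spec (minus one_M f) Hab) as [x0 [Hx0 [_ H]]].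
exists x0; split; [exact Hx0|]; intros x Hx.
assert (E : forall y, Icc a b y -> Rabs (minus one_M f y) = M + -1 * f y).
{ intros y Hy; pointwise; simpl.
  destruct excluded_middle_informative; [|tauto].
  generalize (norm_bound f y); intros; apply Rabs_pos_eq; unfold M; lra. }
generalize (H x Hx); rewrite (E x Hx), (E x0 Hx0); lra.
Qed.

(* [fp_min] is the positive minimum principle; together with linearity it makes [A]
   dissipative and its resolvents positive. *)
Record Feller_pregenerator {a b : R} (A : operator (@Defs.C_NormedModule a b)) : Prop := {
  fp_plus : forall f f' g g' : Cont a b, A f g -> A f' g' -> A (plus f f') (plus g g');
  fp_scal : forall k (f g : Cont a b), A f g -> A (scal k f) (scal k g);
  fp_min : forall (f g : Cont a b) x0, A f g -> Icc a b x0 ->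
    (forall x, Icc a b x -> f x0 <= f x) -> f x0 <= 0 -> 0 <= g x0;
  fp_range : forall h (k : Cont a b), 0 < h ->
    exists f g : Cont a b, A f g /\ minus f (scal h g) = k;
  fp_dense : forall (f : Cont a b) e, 0 < e ->
    exists f' g' : Cont a b, A f' g' /\ norm (minus f' f) <= e }.

Arguments fp_plus {a b A}.
Arguments fp_scal {a b A}.
Arguments fp_min {a b A}.
Arguments fp_range {a b A}.
Arguments fp_dense {a b A}.

(* [(I - h A)^-1] for [h > 0], and the identity otherwise. *)
Definition resolvent {a b : R} (A : operator (@Defs.C_NormedModule a b)) (h : R)
    (k : Cont a b) : Cont a b :=
  if Rlt_dec 0 h
  then epsilon (inhabits C_zero) (fun f => exists g, A f g /\ minus f (scal h g) = k)
  else k.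

(** Dyadic step counts make each scheme the previous one with every step halved, so that consecutive
    schemes are compared step by step through [resolvent_split]. *)
Definition euler {a b : R} (A : operator (@Defs.C_NormedModule a b)) (n : nat) (t : R) :
    Cont a b -> Cont a b :=
  Nat.iter (2 ^ n) (resolvent A (t / 2 ^ n)).

Section Resolvents.
Context {a b : R}.
Implicit Types f g u v w z : Cont a b.
Context (A : operator (@Defs.C_NormedModule a b)) (HA : Feller_pregenerator A).

Lemma pregenerator_minus f f' g g' : A f g -> A f' g' -> A (minus f f') (minus g g').
Proof.
intros H H'.
replace (minus f f') with (plus f (scal (-1) f')) by cont_eq.
replace (minus g g') with (plus g (scal (-1) g')) by cont_eq.
apply (fp_plus HA); [exact H|]; now apply (fp_scal HA).
Qed.

(** At a minimum point with [f x0 < 0] the minimum principle gives [0 <= g x0], hence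
    [f x0 - h * g x0 < 0]. *)
Lemma pregenerator_pos h f g : 0 <= h -> A f g ->
  (forall x, Icc a b x -> 0 <= f x - h * g x) -> forall x, Icc a b x -> 0 <= f x.
Proof.
intros Hh Hfg H x Hx.
destruct (Cont_min_attained f) as [x0 [Hx0 Hm]]; [unfold Icc in Hx; lra|].
apply Rle_trans with (2 := Hm x Hx).
apply Rnot_lt_le; intros Hlt.
assert (0 <= g x0) by (apply (fp_min HA f g x0); auto; lra).
generalize (H x0 Hx0); nra.
Qed.

(** A point where |f| is largest is a nonpositive minimum of [f] or of [-f]; there the minimum
    principle gives [g] the sign for which subtracting [h g] cannot decrease the absolute value. *)
Lemma pregenerator_dissipative h f g : 0 <= h -> A f g ->
  norm f <= norm (minus f (scal h g)).
Proof.
assert (K : forall f g x0, 0 <= h -> A f g -> Icc a b x0 ->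
  (forall x, Icc a b x -> f x0 <= f x) -> f x0 <= 0 ->
  - f x0 <= norm (minus f (scal h g))).
{ intros f' g' x0 Hh Hfg Hx0 Hm H0.
  generalize (norm_bound (minus f' (scal h g')) x0)
    (fp_min HA f' g' x0 Hfg Hx0 Hm H0); pointwise; nra. }
intros Hh Hfg.
destruct (Rle_lt_dec a b) as [Hab|Hab].
2: { change (C_norm f <= norm (minus f (scal h g))).
     rewrite C_norm_empty by exact Hab; apply norm_pos. }
destruct (C_norm_spec f Hab) as [x0 [Hx0 [E Hm]]].
change (norm f) with (C_norm f); rewrite E.
destruct (Rle_lt_dec (f x0) 0) as [Hs|Hs].
- rewrite Rabs_left1 by exact Hs; apply K; auto.
  intros x Hx; generalize (Hm x Hx); rewrite (Rabs_left1 (f x0)) by exact Hs.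
  unfold Rabs; destruct Rcase_abs; lra.
- rewrite Rabs_right by lra.
  replace (norm (minus f (scal h g)))
    with (norm (minus (scal (-1) f) (scal h (scal (-1) g)))).
  + replace (f x0) with (- (scal (-1) f x0)) by (pointwise; ring).
    apply K; auto.
    * now apply (fp_scal HA).
    * intros x Hx; generalize (Hm x Hx); pointwise.
      rewrite (Rabs_right (f x0)) by lra.
      unfold Rabs; destruct Rcase_abs; lra.
    * pointwise; lra.
  + replace (minus (scal (-1) f) (scal h (scal (-1) g)))
      with (minus (scal h g) f) by cont_eq.
    apply norm_minus_sym.
Qed.

Notation V := (resolvent A).

Lemma resolvent_nonpos h k : h <= 0 -> V h k = k.
Proof. intros Hh; unfold resolvent; destruct Rlt_dec; [lra|reflexivity]. Qed.

Lemma resolvent_spec h k : 0 < h -> exists g, A (V h k) g /\ minus (V h k) (scal h g) = k.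
Proof.
intros Hh; unfold resolvent; destruct Rlt_dec; [|lra].
apply (epsilon_spec (inhabits C_zero)
  (fun f => exists g, A f g /\ minus f (scal h g) = k)).
now apply (fp_range HA).
Qed.

(** Dissipativity makes I - hA injective. The algebraic identities for [V] below are proved by
    exhibiting a domain element with the right image. *)
Lemma resolvent_unique h k f g : 0 <= h -> A f g -> minus f (scal h g) = k -> V h k = f.
Proof.
intros Hh Hfg E.
destruct (Rle_lt_dec h 0) as [H0|H0].
- rewrite resolvent_nonpos by exact H0.
  rewrite <- E; replace h with 0 by lra; cont_eq.
- destruct (resolvent_spec h k H0) as [g' [Hg' E']].
  apply norm_minus_eq.
  apply Rle_trans with
    (1 := pregenerator_dissipative h _ _ Hh (pregenerator_minus _ _ _ _ Hg' Hfg)).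
  replace (minus (minus (V h k) f) (scal h (minus g' g)))
    with (minus (minus (V h k) (scal h g')) (minus f (scal h g))) by cont_eq.
  rewrite E, E', norm_minus_diag; lra.
Qed.

Lemma resolvent_contraction h : linear_contraction (V h).
Proof.
destruct (Rle_lt_dec h 0) as [H0|H0].
- split; intros; repeat rewrite (resolvent_nonpos h) by exact H0; auto; apply Rle_refl.
- split.
  + intros f g.
    destruct (resolvent_spec h f H0) as [f' [Hf Ef]].
    destruct (resolvent_spec h g H0) as [g' [Hg Eg]].
    apply (resolvent_unique h _ _ (plus f' g')); [lra|now apply (fp_plus HA)|].
    rewrite <- Ef at 2; rewrite <- Eg at 2; cont_eq.
  + intros k f.
    destruct (resolvent_spec h f H0) as [f' [Hf Ef]].
    apply (resolvent_unique h _ _ (scal k f')); [lra|now apply (fp_scal HA)|].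
    rewrite <- Ef at 2; cont_eq.
  + intros f.
    destruct (resolvent_spec h f H0) as [f' [Hf Ef]].
    rewrite <- Ef at 2; apply pregenerator_dissipative; [lra|exact Hf].
Qed.

Lemma resolvent_positive h f : (forall x, Icc a b x -> 0 <= f x) ->
  forall x, Icc a b x -> 0 <= V h f x.
Proof.
intros H; destruct (Rle_lt_dec h 0) as [H0|H0].
- now rewrite resolvent_nonpos by exact H0.
- destruct (resolvent_spec h f H0) as [f' [Hf Ef]].
  apply (pregenerator_pos h _ f'); [lra|exact Hf|].
  intros x Hx; generalize (H x Hx) (f_equal (fun k : Cont a b => k x) Ef).
  cbv beta; pointwise; lra.
Qed.

(** [f + h V g] solves the resolvent equation, since its image under A is [g + h A (V g) = V g].
    Thus A commutes with the resolvent, and D(A) and D(A^2) are invariant. *)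
Lemma resolvent_domain h f g : 0 <= h -> A f g ->
  A (V h f) (V h g) /\ V h f = plus f (scal h (V h g)).
Proof.
intros Hh Hfg; destruct (Rle_lt_dec h 0) as [H0|H0].
- rewrite !resolvent_nonpos by exact H0; split; [exact Hfg|].
  replace h with 0 by lra; cont_eq.
- destruct (resolvent_spec h g H0) as [g' [Hg Eg]].
  assert (E : plus g (scal h g') = V h g) by cont_eq_from Eg.
  assert (HS : A (plus f (scal h (V h g))) (V h g))
    by exact (eq_ind _ (A _) (fp_plus HA _ _ _ _ Hfg (fp_scal HA h _ _ Hg)) _ E).
  rewrite (resolvent_unique h f _ _ Hh HS) by cont_eq.
  now split.
Qed.

Lemma resolvent_in_domain h f g : 0 <= h -> A f g -> A (V h f) (V h g).
Proof. intros; now apply resolvent_domain. Qed.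

Lemma resolvent_expand h f g : 0 <= h -> A f g -> V h f = plus f (scal h (V h g)).
Proof. intros; now apply resolvent_domain. Qed.

Lemma resolvent_comm h k f : V h (V k f) = V k (V h f).
Proof.
destruct (Rle_lt_dec h 0) as [H0|H0]; [now rewrite !(resolvent_nonpos h)|].
destruct (Rle_lt_dec k 0) as [K0|K0]; [now rewrite !(resolvent_nonpos k)|].
destruct (resolvent_spec h f H0) as [f' [Hf Ef]].
apply (resolvent_unique h _ _ (V k f')); [lra|apply resolvent_in_domain; auto; lra|].
rewrite <- Ef at 2.
rewrite lc_minus, (lc_scal (resolvent_contraction k)) by apply resolvent_contraction.
reflexivity.
Qed.

Lemma iter_resolvent_in_domain h n f g : 0 <= h -> A f g ->
  A (Nat.iter n (V h) f) (Nat.iter n (V h) g).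
Proof. intros Hh Hfg; induction n; [exact Hfg|]; now apply resolvent_in_domain. Qed.

(** Each step adds [h] times the next iterate of [g], because [V p - p = h V (A p)]. This is the
    discrete form of writing the increment of a semigroup orbit as an integral of the orbit of
    [g]. *)
Lemma iter_resolvent_increment h n f g v D : 0 <= h -> A f g ->
  (forall k, (k <= n)%nat -> norm (minus (Nat.iter k (V h) g) v) <= D) ->
  norm (minus (minus (Nat.iter n (V h) f) f) (scal (INR n * h) v)) <= INR n * h * D.
Proof.
intros Hh Hfg; induction n as [|n IH]; intros H.
- simpl; apply norm_le_intro; [lra|]; intros x _; pointwise; lra.
- assert (H1 := H (S n) (Nat.le_refl _)).
  assert (H2 := IH (fun k Hk => H k (Nat.le_trans _ _ _ Hk (Nat.le_succ_diag_r n)))).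
  simpl Nat.iter in *.
  assert (E := resolvent_expand h _ _ Hh (iter_resolvent_in_domain h n f g Hh Hfg)).
  rewrite E; rewrite S_INR.
  set (p := Nat.iter n (V h) f) in *; set (q := V h (Nat.iter n (V h) g)) in *.
  generalize (norm_pos (minus q v)) (pos_INR n); intros.
  assert (0 <= h * D) by nra.
  assert (0 <= INR n * (h * D)) by nra.
  assert (h * norm (minus q v) <= h * D) by nra.
  by_norms (minus (minus p f) (scal (INR n * h) v), minus q v); [nra|].
  set (y := q x + -1 * v x); intros.
  assert (- (h * norm (minus q v)) <= h * y <= h * norm (minus q v)) by nra.
  unfold y in *; nra.
Qed.

Lemma iter_resolvent_displacement h n f g : 0 <= h -> A f g ->
  norm (minus (Nat.iter n (V h) f) f) <= INR n * h * norm g.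
Proof.
intros Hh Hfg.
replace (minus (Nat.iter n (V h) f) f)
  with (minus (minus (Nat.iter n (V h) f) f) (scal (INR n * h) C_zero)) by cont_eq.
apply (iter_resolvent_increment h n f g); auto.
intros k _.
generalize (lc_norm (lc_iter _ k (resolvent_contraction h)) g) (norm_pos g); intros.
by_norms (Nat.iter k (V h) g); lra.
Qed.

(** A resolvent maps D(A) into D(A^2) and moves [u] by at most [h * norm u']; the summand 1 in the
    choice of [h] covers [u' = 0]. *)
Lemma pregenerator_sq_dense f e : 0 < e ->
  exists f' g g', A f' g /\ A g g' /\ norm (minus f' f) <= e.
Proof.
intros He.
destruct (fp_dense HA f (e / 2)) as [u [u' [Hu Du]]]; [lra|].
assert (Hn := norm_pos u').
set (h := e / 2 / (1 + norm u')).
assert (Hh : 0 < h) by (apply Rdiv_lt_0_compat; lra).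
destruct (resolvent_spec h u' Hh) as [u2 [H2 _]].
exists (V h u), (V h u'), u2; split; [|split; [exact H2|]].
- apply resolvent_in_domain; [lra|exact Hu].
- assert (H := iter_resolvent_displacement h 1 u u' (Rlt_le _ _ Hh) Hu); simpl in H.
  assert (Eh : h * (1 + norm u') = e / 2) by (unfold h; field; lra).
  generalize (norm_minus_trans (V h u) u f); lra.
Qed.

(** Expanding twice, [V s (V t f) = f + (s + t) g + (s^2 + s t) V s g' + t^2 V s (V t g')] and [V (s
    + t) f = f + (s + t) g + (s + t)^2 V (s + t) g']. The second-order coefficients sum to at most
    [(s + t)^2] in each, whence the factor 2. *)
Lemma resolvent_split s t f g g' : 0 <= s -> 0 <= t -> A f g -> A g g' ->
  norm (minus (V s (V t f)) (V (s + t) f)) <= 2 * (s + t) * (s + t) * norm g'.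
Proof.
intros Hs Ht H H'.
assert (Hst : 0 <= s + t) by lra.
assert (Cs := resolvent_contraction s).
rewrite (resolvent_expand t f g Ht H), (resolvent_expand t g g' Ht H').
rewrite (resolvent_expand (s + t) f g Hst H), (resolvent_expand (s + t) g g' Hst H').
rewrite !(lc_plus Cs), !(lc_scal Cs), !(lc_plus Cs), !(lc_scal Cs).
rewrite (resolvent_expand s f g Hs H), (resolvent_expand s g g' Hs H').
generalize (norm_pos g') (lc_norm Cs g')
  (lc_norm (resolvent_contraction (s + t)) g')
  (Rle_trans _ _ _ (lc_norm Cs (V t g')) (lc_norm (resolvent_contraction t) g')).
set (n := norm g'); intros Hn N1 N2 N3.
assert (0 <= s * s) by nra; assert (0 <= s * t) by nra; assert (0 <= t * t) by nra.
by_norms (V s g', V (s + t) g', V s (V t g')); [nra|].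
set (p := V s g' x); set (q := V (s + t) g' x); set (r := V s (V t g') x); intros Br Bq Bp.
assert (B : forall k y m, 0 <= k -> - m <= y <= m -> m <= n -> - (k * n) <= k * y <= k * n)
  by (intros; nra).
assert (B1 := B (s * s + s * t) p _ ltac:(lra) Bp N1).
assert (B2 := B ((s + t) * (s + t)) q _ ltac:(nra) Bq N2).
assert (B3 := B (t * t) r _ ltac:(lra) Br N3).
nra.
Qed.

Lemma euler_contraction n t : linear_contraction (euler A n t).
Proof. apply lc_iter, resolvent_contraction. Qed.

Lemma euler_refine n t f g g' : 0 <= t -> A f g -> A g g' ->
  norm (minus (euler A (S n) t f) (euler A n t f)) <= 2 * t * t * norm g' / 2 ^ n.
Proof.
intros Ht H H'.
assert (P : 0 < 2 ^ n) by (apply pow_lt; lra).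
set (h := t / 2 ^ n).
assert (Hh : 0 <= h) by (apply Rdiv_le_0_compat; assumption).
assert (E : forall m f, Nat.iter (2 * m) (V (h / 2)) f
  = Nat.iter m (fun f => V (h / 2) (V (h / 2) f)) f).
{ induction m as [|m IH]; intros f0; [reflexivity|].
  replace (2 * S m)%nat with (S (S (2 * m))) by lia.
  simpl Nat.iter at 1; rewrite IH; reflexivity. }
unfold euler; change (2 ^ S n)%nat with (2 * 2 ^ n)%nat.
replace (t / 2 ^ S n) with (h / 2) by (unfold h; simpl; field; lra).
rewrite E; fold h.
apply Rle_trans with (INR (2 ^ n) * (2 * h * h * norm g')).
- apply iter_close; [apply lc_comp; apply resolvent_contraction|].
  intros k _.
  assert (Hk := iter_resolvent_in_domain h k f g Hh H).
  assert (Hk' := iter_resolvent_in_domain h k g g' Hh H').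
  assert (S1 := resolvent_split (h / 2) (h / 2) _ _ _ ltac:(lra) ltac:(lra) Hk Hk').
  replace (h / 2 + h / 2) with h in S1 by field.
  apply Rle_trans with (1 := S1), Rmult_le_compat_l; [nra|].
  apply lc_norm, lc_iter, resolvent_contraction.
- rewrite pow_INR; unfold h; change (INR 2) with 2; right; field; lra.
Qed.

(** As resolvents commute, the product of the two schemes is an iterate of [V h] after [V k], whose
    single step is compared with [V (h + k)]. This is the semigroup law up to an error that vanishes
    with [n]. *)
Lemma euler_split n s t f g g' : 0 <= s -> 0 <= t -> A f g -> A g g' ->
  norm (minus (euler A n s (euler A n t f)) (euler A n (s + t) f))
    <= 2 * (s + t) * (s + t) * norm g' / 2 ^ n.
Proof.
intros Hs Ht H H'.
assert (P : 0 < 2 ^ n) by (apply pow_lt; lra).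
unfold euler.
set (h := s / 2 ^ n); set (k := t / 2 ^ n).
assert (Hh : 0 <= h) by (apply Rdiv_le_0_compat; assumption).
assert (Hk : 0 <= k) by (apply Rdiv_le_0_compat; assumption).
replace ((s + t) / 2 ^ n) with (h + k) by (unfold h, k; field; lra).
assert (E : forall m f, Nat.iter m (V h) (Nat.iter m (V k) f)
  = Nat.iter m (fun f => V h (V k f)) f).
{ induction m as [|m IH]; intros f0; [reflexivity|].
  simpl; rewrite <- IH; f_equal.
  rewrite (Nat.iter_swap_gen _ _ (V k) (V h) (V h)); [reflexivity|].
  intros; apply resolvent_comm. }
rewrite E.
apply Rle_trans with (INR (2 ^ n) * (2 * (h + k) * (h + k) * norm g')).
- apply iter_close; [apply lc_comp; apply resolvent_contraction|].
  intros j _.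
  assert (Hj := iter_resolvent_in_domain (h + k) j f g ltac:(lra) H).
  assert (Hj' := iter_resolvent_in_domain (h + k) j g g' ltac:(lra) H').
  apply Rle_trans with (1 := resolvent_split h k _ _ _ Hh Hk Hj Hj').
  apply Rmult_le_compat_l; [nra|].
  apply lc_norm, lc_iter, resolvent_contraction.
- rewrite pow_INR; unfold h, k; change (INR 2) with 2; right; field; lra.
Qed.

End Resolvents.

(** * The Hille-Yosida-Ray theorem *)

Lemma pow2_inv_small K e : 0 < e -> exists N, forall n, (N <= n)%nat -> K / 2 ^ n <= e.
Proof.
intros He.
assert (Hk : 0 < e / (Rabs K + 1)).
{ apply Rdiv_lt_0_compat; [exact He|]; generalize (Rabs_pos K); lra. }
destruct (pow_lt_1_zero (/ 2)) with (y := e / (Rabs K + 1)) as [N HN];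
  [rewrite Rabs_pos_eq; lra|exact Hk|].
exists N; intros n Hn.
generalize (HN n Hn); rewrite pow_inv.
assert (P : 0 < / 2 ^ n) by (apply Rinv_0_lt_compat, pow_lt; lra).
rewrite Rabs_pos_eq by lra; intros H.
generalize (Rle_abs K) (Rabs_pos K); intros.
apply Rle_trans with ((Rabs K + 1) * / 2 ^ n); [unfold Rdiv; nra|].
apply Rle_trans with ((Rabs K + 1) * (e / (Rabs K + 1))); [nra|].
right; field; lra.
Qed.

(** The chosen limit exists for every real [t]: for [t < 0] all resolvents involved are the
    identity, so the limit lemmas carry no condition on [t]. *)
Definition hy_semigroup {a b : R} (A : operator (@Defs.C_NormedModule a b)) (t : R)
    (f : Cont a b) : Cont a b :=
  epsilon (inhabits C_zero) (fun l => forall e, 0 < e -> exists N, forall n, (N <= n)%nat ->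
    norm (minus (euler A n t f) l) <= e).

Section HilleYosida.
Context {a b : R}.
Implicit Types f g u v w z : Cont a b.
Context (A : operator (@Defs.C_NormedModule a b)) (HA : Feller_pregenerator A).

Notation S := (hy_semigroup A).

(** The halving error [2 t^2 |g'| / 2^m] equals [4 t^2 |g'| (/ 2^m - / 2^(m+1))], so the errors
    telescope. *)
Lemma euler_cauchy_sq n k t f g g' : 0 <= t -> A f g -> A g g' ->
  norm (minus (euler A (n + k) t f) (euler A n t f))
    <= 4 * t * t * norm g' * (/ 2 ^ n - / 2 ^ (n + k)).
Proof.
intros Ht H H'; induction k as [|k IH].
- rewrite Nat.add_0_r, norm_minus_diag; lra.
- rewrite Nat.add_succ_r.
  assert (H1 := euler_refine A HA (n + k) t f g g' Ht H H').
  assert (H2 := norm_minus_trans (euler A (Datatypes.S (n + k)) t f) (euler A (n + k) t f)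
    (euler A n t f)).
  simpl pow; rewrite Rinv_mult.
  unfold Rdiv in H1; lra.
Qed.

Lemma euler_cauchy t f : forall e, 0 < e -> exists N, forall m n,
  (N <= m)%nat -> (N <= n)%nat -> norm (minus (euler A m t f) (euler A n t f)) <= e.
Proof.
intros e He.
destruct (Rle_lt_dec 0 t) as [Ht|Ht].
- destruct (pregenerator_sq_dense A HA f (e / 4)) as [f' [g [g' [H [H' D]]]]]; [lra|].
  destruct (pow2_inv_small (4 * t * t * norm g') (e / 4)) as [N HN]; [lra|].
  assert (K : forall n, (N <= n)%nat ->
    norm (minus (euler A n t f) (euler A N t f')) <= e / 2).
  { intros n Hn.
    assert (H1 := lc_dist _ f f' (euler_contraction A HA n t)).
    assert (H2 := euler_cauchy_sq N (n - N) t f' g g' Ht H H').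
    replace (N + (n - N))%nat with n in H2 by lia.
    rewrite norm_minus_sym in D.
    assert (H3 := norm_minus_trans (euler A n t f) (euler A n t f') (euler A N t f')).
    assert (P : 0 < / 2 ^ n) by (apply Rinv_0_lt_compat, pow_lt; lra).
    assert (0 <= 4 * t * t * norm g' * / 2 ^ n).
    { apply Rmult_le_pos; [|lra]; generalize (norm_pos g'); nra. }
    generalize (HN N (Nat.le_refl N)); unfold Rdiv at 1; lra. }
  exists N; intros m n Hm Hn.
  generalize (norm_minus_trans (euler A m t f) (euler A N t f') (euler A n t f)).
  rewrite (norm_minus_sym (euler A N t f')).
  generalize (K m Hm) (K n Hn); lra.
- assert (K : forall n, euler A n t f = f).
  { intros n; unfold euler.
    assert (Hn : t / 2 ^ n <= 0).
    { assert (P : 0 < / 2 ^ n) by (apply Rinv_0_lt_compat, pow_lt; lra).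
      unfold Rdiv; nra. }
    induction (2 ^ n)%nat as [|m IH]; [reflexivity|].
    simpl; rewrite IH; now apply resolvent_nonpos. }
  exists O; intros m n _ _; rewrite !K, norm_minus_diag; lra.
Qed.

Lemma hy_semigroup_lim t f e : 0 < e -> exists N, forall n, (N <= n)%nat ->
  norm (minus (euler A n t f) (S t f)) <= e.
Proof.
revert e; apply (epsilon_spec (inhabits C_zero) (fun l => forall e, 0 < e ->
  exists N, forall n, (N <= n)%nat -> norm (minus (euler A n t f) l) <= e)).
apply Cont_seq_complete, euler_cauchy.
Qed.

(** Passes an eventual bound on the Euler schemes to the limit; most properties of [S] below are
    reduced through it to finite iterates of resolvents. *)
Lemma hy_semigroup_bound t f v M :
  (exists N, forall n, (N <= n)%nat -> norm (minus (euler A n t f) v) <= M) ->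
  norm (minus (S t f) v) <= M.
Proof.
intros [N HN]; apply le_epsilon; intros e He.
destruct (hy_semigroup_lim t f e He) as [N' HN'].
assert (H1 := HN (N + N')%nat ltac:(lia)).
assert (H2 := HN' (N + N')%nat ltac:(lia)).
rewrite norm_minus_sym in H2.
generalize (norm_minus_trans (S t f) (euler A (N + N') t f) v); lra.
Qed.

Lemma hy_semigroup_contraction t : linear_contraction (S t).
Proof.
split.
- intros f g; apply norm_minus_small_eq; intros e He; apply hy_semigroup_bound.
  destruct (hy_semigroup_lim t f (e / 2)) as [N HN]; [lra|].
  destruct (hy_semigroup_lim t g (e / 2)) as [N' HN']; [lra|].
  exists (N + N')%nat; intros n Hn.
  rewrite (lc_plus (euler_contraction A HA n t)).
  generalize (HN n ltac:(lia)) (HN' n ltac:(lia)); intros.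
  by_norms (minus (euler A n t f) (S t f), minus (euler A n t g) (S t g)); lra.
- intros k f; apply norm_minus_small_eq; intros e He; apply hy_semigroup_bound.
  assert (Hk : 0 < Rabs k + 1) by (generalize (Rabs_pos k); lra).
  destruct (hy_semigroup_lim t f (e / (Rabs k + 1))) as [N HN];
    [now apply Rdiv_lt_0_compat|].
  exists N; intros n Hn.
  rewrite (lc_scal (euler_contraction A HA n t)).
  apply (norm_le_subst _ (scal k (minus (euler A n t f) (S t f)))); [cont_eq|].
  apply Rle_trans with (1 := C_norm_scal k _).
  apply Rle_trans with (Rabs k * (e / (Rabs k + 1))).
  + apply Rmult_le_compat_l; [apply Rabs_pos|exact (HN n Hn)].
  + apply Rle_trans with ((Rabs k + 1) * (e / (Rabs k + 1))).
    * apply Rmult_le_compat_r; [apply Rlt_le, Rdiv_lt_0_compat; assumption|lra].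
    * right; field; lra.
- intros f.
  apply (norm_le_subst _ (minus (S t f) C_zero)); [cont_eq|].
  apply hy_semigroup_bound; exists O; intros n _.
  apply (norm_le_subst _ (euler A n t f)); [cont_eq|].
  apply (lc_norm (euler_contraction A HA n t)).
Qed.

Lemma hy_semigroup_positive t f : (forall x, Icc a b x -> 0 <= f x) ->
  forall x, Icc a b x -> 0 <= S t f x.
Proof.
intros H x Hx.
assert (K : forall n x, Icc a b x -> 0 <= euler A n t f x).
{ intros n; unfold euler; induction (2 ^ n)%nat as [|m IH]; [exact H|].
  simpl; now apply resolvent_positive. }
apply Rnot_lt_le; intros Hlt.
destruct (hy_semigroup_lim t f (- S t f x / 2)) as [N HN]; [lra|].
generalize (HN N (Nat.le_refl N)) (K N x Hx)
  (norm_bound (minus (euler A N t f) (S t f)) x); pointwise; lra.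
Qed.

Lemma hy_semigroup_0 f : S 0 f = f.
Proof.
apply norm_minus_small_eq; intros e He; apply hy_semigroup_bound.
exists O; intros n _.
replace (euler A n 0 f) with f; [rewrite norm_minus_diag; lra|].
unfold euler; induction (2 ^ n)%nat as [|m IH]; [reflexivity|].
simpl; rewrite <- IH, resolvent_nonpos; [reflexivity|].
unfold Rdiv; rewrite Rmult_0_l; lra.
Qed.

Lemma hy_semigroup_plus s t f : 0 <= s -> 0 <= t -> S (s + t) f = S s (S t f).
Proof.
intros Hs Ht; apply norm_minus_small_eq; intros e He; apply hy_semigroup_bound.
destruct (pregenerator_sq_dense A HA f (e / 8)) as [f' [g [g' [H [H' D]]]]]; [lra|].
destruct (pow2_inv_small (2 * (s + t) * (s + t) * norm g') (e / 4)) as [N HN]; [lra|].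
destruct (hy_semigroup_lim t f (e / 4)) as [N' HN']; [lra|].
destruct (hy_semigroup_lim s (S t f) (e / 4)) as [N'' HN'']; [lra|].
exists (N + N' + N'')%nat; intros n Hn.
assert (E := euler_contraction A HA n).
assert (H1 := lc_dist _ f' f (E (s + t))).
assert (H2 := lc_dist _ _ _ (E s) : norm (minus (euler A n s (euler A n t f'))
  (euler A n s (euler A n t f))) <= _).
assert (H3 := lc_dist _ f' f (E t)).
assert (H4 := lc_dist _ _ _ (E s) : norm (minus (euler A n s (euler A n t f))
  (euler A n s (S t f))) <= _).
assert (H5 := HN' n ltac:(lia)).
assert (H6 := HN'' n ltac:(lia)).
assert (H7 := euler_split A HA n s t f' g g' Hs Ht H H').
assert (H8 := HN n ltac:(lia)).
(* Replacing [f] by [f'] in D(A^2) costs [e / 8] twice; the two limits and the splitting error cost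
   [e / 4] each. *)
by_norms (minus (euler A n (s + t) f') (euler A n (s + t) f),
  minus (euler A n s (euler A n t f')) (euler A n s (euler A n t f)),
  minus (euler A n s (euler A n t f)) (euler A n s (S t f)),
  minus (euler A n s (S t f)) (S s (S t f)),
  minus (euler A n s (euler A n t f')) (euler A n (s + t) f')); lra.
Qed.

Lemma hy_semigroup_increment t f g v D : 0 <= t -> A f g ->
  (forall s n k, 0 <= s -> INR k * s <= t -> s = t / 2 ^ n ->
     norm (minus (Nat.iter k (resolvent A s) g) v) <= D) ->
  norm (minus (minus (S t f) f) (scal t v)) <= t * D.
Proof.
intros Ht Hfg H.
apply (norm_le_subst _ (minus (S t f) (plus f (scal t v)))); [cont_eq|].
apply hy_semigroup_bound; exists O; intros n _; unfold euler.
assert (P : 0 < 2 ^ n) by (apply pow_lt; lra).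
assert (Hs : 0 <= t / 2 ^ n) by (apply Rdiv_le_0_compat; assumption).
assert (E : INR (2 ^ n) * (t / 2 ^ n) = t).
{ rewrite pow_INR; change (INR 2) with 2; field; lra. }
assert (H1 := iter_resolvent_increment A HA (t / 2 ^ n) (2 ^ n) f g v D Hs Hfg).
rewrite E in H1.
apply (norm_le_subst _
  (minus (minus (Nat.iter (2 ^ n) (resolvent A (t / 2 ^ n)) f) f) (scal t v))); [cont_eq|].
apply H1; intros k Hk; apply (H _ n); auto.
rewrite <- E at 2; apply Rmult_le_compat_r; [exact Hs|].
now apply le_INR.
Qed.

Lemma iter_resolvent_continuity h k g u u' : 0 <= h -> A u u' ->
  norm (minus (Nat.iter k (resolvent A h) g) g)
    <= 2 * norm (minus u g) + INR k * h * norm u'.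
Proof.
intros Hh Hu.
assert (H1 := lc_dist _ u g (lc_iter _ k (resolvent_contraction A HA h))).
assert (H2 := iter_resolvent_displacement A HA h k u u' Hh Hu).
generalize (norm_pos (minus (Nat.iter k (resolvent A h) u) u)) (norm_pos (minus u g)); intros.
by_norms (minus (Nat.iter k (resolvent A h) u) (Nat.iter k (resolvent A h) g),
  minus (Nat.iter k (resolvent A h) u) u, minus u g); lra.
Qed.

(** The difference quotient is a limit of averages of iterates of [g] over times up to [t]; these
    stay near [g], since [g] is approximated by [u] in D(A), whose iterates move by at most
    [t * norm u']. *)
Lemma hy_semigroup_derivative f g : A f g ->
  filterlim (fun t => scal (/ t) (minus (S t f) f)) (at_right 0) (locally g).
Proof.
intros Hfg; apply filterlim_at_right_norm; intros e He.
destruct (fp_dense HA g (e / 8)) as [u [u' [Hu Du]]]; [lra|].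
assert (Hn := norm_pos u').
exists (e / 4 / (1 + norm u')); split; [apply Rdiv_lt_0_compat; lra|].
intros t Ht.
assert (Ht' : t * norm u' <= e / 4).
{ assert (E : e / 4 / (1 + norm u') * (1 + norm u') = e / 4) by (field; lra).
  nra. }
assert (H := hy_semigroup_increment t f g g (e / 2) ltac:(lra) Hfg).
apply Rle_lt_trans with (/ t * (t * (e / 2))).
- apply (norm_le_subst _ (scal (/ t) (minus (minus (S t f) f) (scal t g)))).
  { apply C_ext; intros; pointwise; field; lra. }
  apply Rle_trans with (/ t * norm (minus (minus (S t f) f) (scal t g))).
  + apply norm_scal_le, Rlt_le, Rinv_0_lt_compat; lra.
  + apply Rmult_le_compat_l; [apply Rlt_le, Rinv_0_lt_compat; lra|].
    apply H; intros s n k Hs Hks _.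
    apply Rle_trans with (1 := iter_resolvent_continuity s k g u u' Hs Hu); nra.
- rewrite <- Rmult_assoc, Rinv_l by lra; lra.
Qed.

Lemma hy_semigroup_cont f : filterlim (fun t => S t f) (at_right 0) (locally f).
Proof.
apply filterlim_at_right_norm; intros e He.
destruct (fp_dense HA f (e / 8)) as [u [u' [Hu Du]]]; [lra|].
assert (Hn := norm_pos u').
exists (e / 4 / (1 + norm u')); split; [apply Rdiv_lt_0_compat; lra|].
intros t Ht.
assert (Ht' : t * norm u' <= e / 4).
{ assert (E : e / 4 / (1 + norm u') * (1 + norm u') = e / 4) by (field; lra).
  nra. }
apply Rle_lt_trans with (e / 2); [|lra].
apply hy_semigroup_bound; exists O; intros n _; unfold euler.
assert (P : 0 < 2 ^ n) by (apply pow_lt; lra).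
assert (Hs : 0 <= t / 2 ^ n) by (apply Rdiv_le_0_compat; lra).
apply Rle_trans with (1 := iter_resolvent_continuity _ _ f u u' Hs Hu).
replace (INR (2 ^ n) * (t / 2 ^ n)) with t; [lra|].
rewrite pow_INR; change (INR 2) with 2; field; lra.
Qed.

(* Range condition: [f - g = f' - A f'] for some [f'], so [u = f - f'] has derivative [u]
   under the semigroup, and [(1 + t) |u| <= |S t u| + o(t)] forces [u = 0]. *)
Lemma hy_semigroup_maximal f g :
  filterlim (fun t => scal (/ t) (minus (S t f) f)) (at_right 0) (locally g) -> A f g.
Proof.
intros Hlim.
destruct (fp_range HA 1 (minus f g)) as [f' [g' [H E]]]; [lra|].
assert (E1 : minus g g' = minus f f').
{ apply C_ext; intros y _; generalize (f_equal (fun k => cfun k y) E).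
  cbv beta; pointwise; intros; lra. }
assert (Ef : f = f').
{ apply norm_minus_small_eq; intros e He.
  destruct (proj1 (filterlim_at_right_norm _ _) Hlim (e / 2)) as [d [Hd K]]; [lra|].
  destruct (proj1 (filterlim_at_right_norm _ _) (hy_semigroup_derivative _ _ H) (e / 2))
    as [d' [Hd' K']]; [lra|].
  set (t := Rmin d d' / 2).
  assert (Ht : 0 < t /\ t < d /\ t < d')
    by (unfold t, Rmin; destruct Rle_dec; lra).
  specialize (K t ltac:(lra)); specialize (K' t ltac:(lra)).
  assert (C := lc_dist _ f f' (hy_semigroup_contraction t)).
  set (q := minus (scal (/ t) (minus (S t f) f)) g).
  set (q' := minus (scal (/ t) (minus (S t f') f')) g').
  change (norm q < e / 2) in K; change (norm q' < e / 2) in K'.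
  assert (B : (1 + t) * norm (minus f f') <= norm (minus f f') + t * e).
  { apply Rmult_le_reg_l with (/ (1 + t)); [apply Rinv_0_lt_compat; lra|].
    rewrite <- Rmult_assoc, Rinv_l, Rmult_1_l by lra.
    assert (Hi : 0 < / (1 + t)) by (apply Rinv_0_lt_compat; lra).
    generalize (norm_pos (minus f f')); intros Hn.
    apply norm_le_intro; [apply Rmult_le_pos; nra|]; intros x _.
    (* Because [g - g' = f - f'], the first-order term in the increment of [S t (f - f')] is
       [t (f - f')] itself, which produces the factor [1 + t]. *)
    assert (I : (1 + t) * minus f f' x = minus (S t f) (S t f') x - t * (q x - q' x)).
    { generalize (f_equal (fun k => cfun k x) E1); unfold q, q'; cbv beta; pointwise.
      intros E2; replace (g x) with (g' x + (f x - f' x)) by lra; field; lra. }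
    replace (minus f f' x) with (/ (1 + t) * ((1 + t) * minus f f' x)) by (field; lra).
    rewrite I, <- Ropp_mult_distr_r_reverse.
    generalize (norm_bound (minus (S t f) (S t f')) x) (norm_bound q x) (norm_bound q' x).
    intros B1 B2 B3.
    assert (Bq : - e <= q x - q' x <= e) by lra.
    assert (Bt : - (t * e) <= t * (q x - q' x) <= t * e) by nra.
    split; (apply Rmult_le_compat_l; [lra|]); lra. }
  nra. }
subst f'; replace g with g'; [exact H|].
apply C_ext; intros y _; generalize (f_equal (fun k => cfun k y) E1).
cbv beta; pointwise; lra.
Qed.

Theorem Hille_Yosida_Ray : Feller_generator A.
Proof.
exists S; split.
- split.
  + split.
    * intros t _; split.
      -- apply (lc_plus (hy_semigroup_contraction t)).
      -- apply (lc_scal (hy_semigroup_contraction t)).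
      -- exists 1; split; [lra|]; intros f; rewrite Rmult_1_l.
         apply (lc_norm (hy_semigroup_contraction t)).
    * exact hy_semigroup_0.
    * exact hy_semigroup_plus.
    * exact hy_semigroup_cont.
  + intros t f _; apply hy_semigroup_positive.
  + intros t f _; apply (lc_norm (hy_semigroup_contraction t)).
- intros f g; split; [apply hy_semigroup_derivative|apply hy_semigroup_maximal].
Qed.

End HilleYosida.

(** * Convergence of semigroups *)

Section GeneratedSemigroup.
Context {a b : R}.
Implicit Types f g u v w y z : Cont a b.
Context (G : operator (@Defs.C_NormedModule a b)) (T : R -> Cont a b -> Cont a b)
  (HT : Feller_semigroup T) (HG : generates G T).

Lemma Feller_contraction t : 0 <= t -> linear_contraction (T t).
Proof.
intros Ht; destruct (sg_linear T (Feller_sg T HT) t Ht) as [Hp Hs _].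
split; [exact Hp|exact Hs|]; intros f; now apply (Feller_contr T HT).
Qed.

(** Stands in for the integral formula for [T t w - w]. Cut [0,t] into [n] steps of length [h < d]:
    by the definition of the generator a step is [h z] up to [h (e / t)], [T (k h)] transports this
    error without enlarging it, and [T (k h) z] is within [D] of [v]. *)
Lemma semigroup_increment t w z v D : 0 <= t -> G w z ->
  (forall s, 0 <= s <= t -> norm (minus (T s z) v) <= D) ->
  norm (minus (minus (T t w) w) (scal t v)) <= t * D.
Proof.
intros Ht Hwz HD.
destruct (Rle_lt_or_eq_dec 0 t Ht) as [Ht0|<-].
2: { rewrite (sg_zero T (Feller_sg T HT)).
     apply norm_le_intro; [lra|]; intros x _; pointwise; lra. }
apply le_epsilon; intros e He.
destruct (proj1 (filterlim_at_right_norm _ _) (proj1 (HG w z) Hwz) (e / t))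
  as [d [Hd Hlim]]; [now apply Rdiv_lt_0_compat|].
destruct (nfloor_ex (t / d)) as [m [_ Hm]]; [apply Rlt_le; now apply Rdiv_lt_0_compat|].
set (n := S m).
assert (Hn : t / d < INR n) by (unfold n; rewrite S_INR; exact Hm).
assert (Hn0 : 0 < INR n).
{ apply Rle_lt_trans with (2 := Hn), Rlt_le; now apply Rdiv_lt_0_compat. }
set (h := t / INR n).
assert (Hh : 0 < h) by now apply Rdiv_lt_0_compat.
assert (Ehn : INR n * h = t) by (unfold h; field; lra).
assert (Hhd : h < d).
{ apply Rmult_lt_reg_l with (INR n); [exact Hn0|]; rewrite Ehn.
  apply Rmult_lt_compat_r with (r := d) in Hn; [|exact Hd].
  replace (t / d * d) with t in Hn by (field; lra); lra. }
assert (Hstep : norm (minus (minus (T h w) w) (scal h z)) <= h * (e / t)).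
{ apply (norm_le_subst _ (scal h (minus (scal (/ h) (minus (T h w) w)) z))).
  - apply C_ext; intros; pointwise; field; lra.
  - apply Rle_trans with (1 := norm_scal_le h _ (Rlt_le _ _ Hh)).
    apply Rmult_le_compat_l; [lra|]; apply Rlt_le, Hlim; lra. }
assert (K : forall k, (k <= n)%nat ->
  norm (minus (minus (T (INR k * h) w) w) (scal (INR k * h) v))
    <= INR k * h * (D + e / t)).
{ induction k as [|k IH]; intros Hk.
  - simpl; rewrite Rmult_0_l, (sg_zero T (Feller_sg T HT)).
    apply norm_le_intro; [lra|]; intros x _; pointwise; lra.
  - assert (Hk0 := pos_INR k).
    assert (Hkh : 0 <= INR k * h) by nra.
    assert (HkT : INR k * h <= t).
    { rewrite <- Ehn; apply Rmult_le_compat_r; [lra|]; apply le_INR; lia. }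
    specialize (IH ltac:(lia)).
    specialize (HD (INR k * h) ltac:(lra)).
    assert (C := Feller_contraction _ Hkh).
    assert (H1 := lc_norm C (minus (minus (T h w) w) (scal h z))).
    rewrite !lc_minus, (lc_scal C) in H1 by exact C.
    rewrite S_INR.
    replace ((INR k + 1) * h) with (INR k * h + h) by ring.
    rewrite (sg_plus T (Feller_sg T HT)) by lra.
    generalize (norm_pos (minus (T (INR k * h) z) v)); intros P1.
    generalize (norm_pos (minus (minus (T (INR k * h) w) w) (scal (INR k * h) v))); intros P2.
    generalize (norm_pos (minus (minus (T h w) w) (scal h z))); intros P3.
    assert (P4 : h * norm (minus (T (INR k * h) z) v) <= h * D) by nra.
    by_norms (minus (minus (T (INR k * h) w) w) (scal (INR k * h) v),
      minus (minus (T (INR k * h) (T h w)) (T (INR k * h) w)) (scal h (T (INR k * h) z)),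
      scal h (minus (T (INR k * h) z) v)).
    + nra.
    + generalize (norm_scal_le h (minus (T (INR k * h) z) v) (Rlt_le _ _ Hh)); nra. }
specialize (K n (Nat.le_refl n)); rewrite Ehn in K.
replace (t * D + e) with (t * (D + e / t)) by (field; lra); exact K.
Qed.

Lemma semigroup_displacement t w z : 0 <= t -> G w z ->
  norm (minus (T t w) w) <= t * norm z.
Proof.
intros Ht Hwz.
apply (norm_le_subst _ (minus (minus (T t w) w) (scal t C_zero))); [cont_eq|].
apply (semigroup_increment t w z); auto.
intros s Hs; apply (norm_le_subst _ (T s z)); [cont_eq|].
apply lc_norm, Feller_contraction; lra.
Qed.

Lemma semigroup_continuity t f w z : 0 <= t -> G w z ->
  norm (minus (T t f) f) <= 2 * norm (minus w f) + t * norm z.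
Proof.
intros Ht Hwz.
assert (H1 := lc_dist _ w f (Feller_contraction t Ht)).
assert (H2 := semigroup_displacement t w z Ht Hwz).
generalize (norm_pos (minus w f)) (norm_pos (minus (T t w) w)); intros.
by_norms (minus (T t w) (T t f), minus (T t w) w, minus w f); lra.
Qed.

(** The implicit step ending at [w] starts at [w - h z]; the semigroup is run over the same step.
    The pair [(w', z')] gives the first-order expansion of [T h w]. The second pair is needed since
    [z'] may lie outside the domain of [G]: the bound [T s z = z + O(s)] comes from [y], a domain
    element near [z] and [z']. *)
Lemma implicit_step_error h w z v d w' z' y y' : 0 <= h -> G w' z' -> G y y' ->
  norm (minus w' w) <= d -> norm (minus z' z) <= d ->
  norm (minus y z) <= d -> norm (minus y' v) <= d ->
  norm (minus (T h (minus w (scal h z))) w)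
    <= 2 * h * h * norm v + d * (2 + 7 * h + 2 * h * h).
Proof.
intros Hh Hw Hy Dw Dz Dy Dy'.
assert (C := Feller_contraction h Hh).
assert (Ny : norm y' <= norm v + d).
{ generalize (norm_pos v) (norm_pos (minus y' v)); intros.
  by_norms (v, minus y' v); lra. }
assert (Nz : norm (minus y z') <= 2 * d).
{ generalize (norm_minus_trans y z z'); rewrite (norm_minus_sym z z'); lra. }
assert (H1 := semigroup_increment h w' z' z' (4 * d + h * (norm v + d)) Hh Hw).
assert (H2 : norm (minus (minus (T h w') w') (scal h z')) <= h * (4 * d + h * (norm v + d))).
{ apply H1; intros s Hs.
  generalize (semigroup_continuity s z' y y' (proj1 Hs) Hy) (norm_pos y'); nra. }
assert (H3 := semigroup_continuity h z y y' Hh Hy).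
assert (H4 := lc_dist _ w' w C).
assert (Dp := Rle_trans _ _ _ (norm_pos _) Dw).
rewrite lc_minus, (lc_scal C) by exact C.
assert (H5 := Rle_trans _ _ _ (norm_scal_le h (minus z' z) Hh)
  (Rmult_le_compat_l h _ _ Hh Dz)).
assert (H6 : norm (scal h (minus (T h z) z)) <= h * (2 * d + h * (norm v + d))).
{ apply Rle_trans with (1 := norm_scal_le h _ Hh).
  apply Rmult_le_compat_l; [exact Hh|]; generalize (norm_pos y'); nra. }
generalize (norm_pos v); intros Hv.
assert (0 <= h * h) by nra.
assert (0 <= h * h * norm v) by nra.
assert (0 <= h * d) by nra.
assert (0 <= h * h * d) by nra.
by_norms (minus (T h w') (T h w), minus (minus (T h w') w') (scal h z'), minus w' w,
  scal h (minus z' z), scal h (minus (T h z) z)); nra.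
Qed.

End GeneratedSemigroup.

Lemma at_right_0_unit : at_right 0 (fun eps => 0 < eps <= 1).
Proof.
exists (mkposreal 1 Rlt_0_1); intros y Hy Hy0; split; [exact Hy0|].
change (Rabs (y - 0) < 1) in Hy; revert Hy; unfold Rabs; destruct Rcase_abs; lra.
Qed.

(** * Comparison of semigroups through a common Euler scheme *)

Section TrotterKato.
Context {a b : R}.
Implicit Types f g u v w y z : Cont a b.
Context (A : operator (@Defs.C_NormedModule a b)) (HA : Feller_pregenerator A).

(** The graph of [A] is contained in the extended limit of the graphs of [Geps]. The approximating
    pair may vary with eps, as it must when [w] belongs to none of the approximating domains. *)
Definition extended_limit (Geps : R -> operator (@Defs.C_NormedModule a b)) : Prop :=
  forall w z, A w z -> forall d, 0 < d -> at_right 0 (fun eps =>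
    exists w' z', Geps eps w' z' /\ norm (minus w' w) <= d /\ norm (minus z' z) <= d).

(** Earlier errors pass through a contraction and each step adds one consistency error. [N] is fixed
    before eps because every iterate imposes its own smallness condition on eps, and a filter admits
    finitely many of them. *)
Lemma euler_approximates_semigroups Geps (Teps : R -> R -> Cont a b -> Cont a b)
    h N f g v e :
  extended_limit Geps ->
  (forall eps, 0 < eps <= 1 -> Feller_semigroup (Teps eps) /\ generates (Geps eps) (Teps eps)) ->
  0 < h -> A f g -> A g v -> 0 < e ->
  at_right 0 (fun eps => forall n, (n <= N)%nat ->
    norm (minus (Teps eps (INR n * h) f) (Nat.iter n (resolvent A h) f))
      <= INR n * (2 * h * h * norm v + e)).
Proof.
intros Hlim Hgen Hh Hf Hg He; induction N as [|N IH].
- apply filter_imp with (2 := at_right_0_unit); intros eps Heps n Hn.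
  replace n with O by lia; simpl.
  rewrite Rmult_0_l, (sg_zero _ (Feller_sg _ (proj1 (Hgen eps Heps)))), norm_minus_diag; lra.
- set (V := resolvent A h) in *.
  (* The step is described by its endpoint, [V^N f = w - h z] with [z = A w]; hence iterates of
     index [S N]. *)
  pose (w := Nat.iter (S N) V f); pose (z := Nat.iter (S N) V g); pose (v' := Nat.iter (S N) V v).
  assert (Hw : A w z) by (apply iter_resolvent_in_domain; auto; lra).
  assert (Hz : A z v') by (apply iter_resolvent_in_domain; auto; lra).
  set (d := e / (2 + 7 * h + 2 * h * h)).
  assert (Hden : 0 < 2 + 7 * h + 2 * h * h) by nra.
  assert (Hd : 0 < d) by now apply Rdiv_lt_0_compat.
  assert (Hall := filter_and _ _ (filter_and _ _ IH at_right_0_unit)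
    (filter_and _ _ (Hlim w z Hw d Hd) (Hlim z v' Hz d Hd))).
  revert Hall; apply filter_imp; clear IH.
  intros eps [[IH Heps] [[w' [z' [H1 [H2 H3]]]] [y [y' [H4 [H5 H6]]]]]] n Hn.
  destruct (proj1 (Nat.lt_eq_cases n (S N)) Hn) as [Hlt| ->]; [apply IH; lia|].
  destruct (Hgen eps Heps) as [HT HG].
  assert (L := implicit_step_error _ _ HT HG h w z v' d w' z' y y'
    ltac:(lra) H1 H4 H2 H3 H5 H6).
  replace (d * (2 + 7 * h + 2 * h * h)) with e in L by (unfold d; field; lra).
  assert (E : minus w (scal h z) = Nat.iter N V f).
  { assert (X : w = plus (Nat.iter N V f) (scal h z)).
    { apply (resolvent_expand A HA); [lra|].
      apply iter_resolvent_in_domain; auto; lra. }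
    cont_eq_from X. }
  rewrite E in L.
  assert (Nv : norm v' <= norm v) by apply lc_norm, lc_iter, resolvent_contraction, HA.
  assert (C := Feller_contraction _ HT h (Rlt_le _ _ Hh)).
  specialize (IH N (Nat.le_refl N)).
  assert (D := lc_dist _ (Teps eps (INR N * h) f) (Nat.iter N V f) C).
  rewrite S_INR.
  replace ((INR N + 1) * h) with (h + INR N * h) by ring.
  assert (HN := pos_INR N).
  rewrite (sg_plus _ (Feller_sg _ HT)) by nra.
  change (Nat.iter (S N) V f) with w.
  apply Rle_trans with (1 := norm_minus_trans _ (Teps eps h (Nat.iter N V f)) _).
  nra.
Qed.

(** [Teps eps] and [T] are compared with the same Euler scheme at the grid points [n h]; from a grid
    point to [t] both move [u] little. Here [T] is any Feller semigroup generated by [A], whether or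
    not it is the limit of Euler schemes constructed above. *)
Theorem Trotter_Kato Geps (Teps : R -> R -> Cont a b -> Cont a b) T t0 f e :
  extended_limit Geps ->
  (forall eps, 0 < eps <= 1 -> Feller_semigroup (Teps eps) /\ generates (Geps eps) (Teps eps)) ->
  Feller_semigroup T -> generates A T -> 0 < e ->
  at_right 0 (fun eps => forall t, 0 <= t <= t0 ->
    norm (minus (Teps eps t f) (T t f)) < e).
Proof.
intros Hlim Hgen HT HG He.
destruct (pregenerator_sq_dense A HA f (e / 8)) as [u [g [v [Hu [Hg Du]]]]]; [lra|].
assert (Ng := norm_pos g); assert (Nv := norm_pos v); assert (Nt := Rabs_pos t0).
(* [K] collects the coefficients of [h] in the final estimate: two displacements off the grid and
   two Euler errors, each step contributing [h^2 (2 |v| + 1)] over a total time of at most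
   [|t0|]. *)
set (K := 2 * norm g + 2 * Rabs t0 * (2 * norm v + 1) + 1).
assert (HK : 0 < K) by (unfold K; nra).
set (h := Rmin 1 (e / 8 / K)).
assert (Hh : 0 < h) by (apply Rmin_glb_lt; [lra|]; apply Rdiv_lt_0_compat; lra).
assert (Hh1 : h <= 1) by apply Rmin_l.
assert (HhK : h * K <= e / 8).
{ apply Rle_trans with (e / 8 / K * K); [|right; field; lra].
  apply Rmult_le_compat_r; [lra|apply Rmin_r]. }
destruct (nfloor_ex (Rabs t0 / h)) as [N [_ HN]]; [now apply Rdiv_le_0_compat|].
assert (Hhh : 0 < h * h) by nra.
(* [T] is covered by the same lemma as a constant family; the resulting bound is free of eps, so a
   single eps from the filter yields it. *)
assert (HT' : extended_limit (fun _ => A)).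
{ intros w z Hwz d Hd; apply filter_forall; intros _; exists w, z.
  rewrite !norm_minus_diag; repeat split; auto; lra. }
destruct (filter_ex (F := at_right 0) _
  (euler_approximates_semigroups (fun _ => A) (fun _ => T) h (S N) u g v (h * h) HT'
    (fun _ _ => conj HT HG) Hh Hu Hg Hhh)) as [_ HE].
assert (Hall := filter_and (F := at_right 0) _ _ (filter_and (F := at_right 0) _ _ at_right_0_unit
  (Hlim u g Hu (e / 16) ltac:(lra)))
  (euler_approximates_semigroups Geps Teps h (S N) u g v (h * h) Hlim Hgen Hh Hu Hg Hhh)).
revert Hall; apply filter_imp.
intros eps [[Heps [w' [z' [H1 [H2 H3]]]]] HEeps] t Ht.
destruct (Hgen eps Heps) as [HTe HGe].
assert (Et0 : Rabs t0 = t0) by (apply Rabs_pos_eq; lra).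
rewrite Et0 in *.
destruct (nfloor_ex (t / h)) as [n [Hn1 Hn2]]; [apply Rdiv_le_0_compat; lra|].
assert (Hnt : INR n * h <= t).
{ apply Rmult_le_compat_r with (r := h) in Hn1; [|lra].
  replace (t / h * h) with t in Hn1 by (field; lra); exact Hn1. }
assert (Hnt' : t - INR n * h <= h).
{ apply Rmult_lt_compat_r with (r := h) in Hn2; [|lra].
  replace (t / h * h) with t in Hn2 by (field; lra); lra. }
assert (HnN : (n <= S N)%nat).
{ apply INR_le; rewrite S_INR; apply Rle_trans with (1 := Hn1), Rlt_le.
  apply Rle_lt_trans with (2 := HN).
  apply Rmult_le_compat_r; [apply Rlt_le, Rinv_0_lt_compat; lra|lra]. }
specialize (HE n HnN); specialize (HEeps n HnN).
assert (Hn0 := pos_INR n).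
set (r := t - INR n * h) in *.
assert (Hr : 0 <= r) by (unfold r; lra).
assert (Hnh : 0 <= INR n * h) by nra.
assert (Et : t = INR n * h + r) by (unfold r; ring).
assert (Rt : norm (minus (T t u) (T (INR n * h) u)) <= h * norm g).
{ rewrite Et, (sg_plus _ (Feller_sg _ HT)) by lra.
  apply Rle_trans with (1 := lc_dist _ _ _ (Feller_contraction _ HT _ Hnh)).
  apply Rle_trans with (1 := semigroup_displacement _ _ HT HG r u g Hr Hu).
  apply Rmult_le_compat_r; lra. }
assert (Re : norm (minus (Teps eps t u) (Teps eps (INR n * h) u))
  <= e / 8 + h * (norm g + e / 16)).
{ rewrite Et, (sg_plus _ (Feller_sg _ HTe)) by lra.
  apply Rle_trans with (1 := lc_dist _ _ _ (Feller_contraction _ HTe _ Hnh)).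
  apply Rle_trans with (1 := semigroup_continuity _ _ HTe HGe r u w' z' Hr H1).
  assert (Nz : norm z' <= norm g + e / 16).
  { by_norms (g, minus z' g); lra. }
  generalize (norm_pos z'); nra. }
assert (Rf := lc_dist _ u f (Feller_contraction _ HT t (proj1 Ht))).
assert (Rfe := lc_dist _ u f (Feller_contraction _ HTe t (proj1 Ht))).
assert (B : INR n * (2 * h * h * norm v + h * h) <= t0 * (h * (2 * norm v + 1))).
{ replace (INR n * (2 * h * h * norm v + h * h))
    with (INR n * h * (h * (2 * norm v + 1))) by ring.
  apply Rmult_le_compat_r; nra. }
apply Rle_lt_trans with (e / 4 + (e / 8 + h * (norm g + e / 16)) + h * norm g
  + 2 * (t0 * (h * (2 * norm v + 1)))).
2: { unfold K in HhK; nra. }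
assert (X1 := norm_pos (minus (Teps eps t u) (Teps eps (INR n * h) u))).
assert (X2 := norm_pos (minus (T t u) (T (INR n * h) u))).
assert (X3 := norm_pos (minus (T (INR n * h) u) (Nat.iter n (resolvent A h) u))).
by_norms (minus (T t u) (T t f), minus (Teps eps t u) (Teps eps t f),
  minus (T t u) (T (INR n * h) u), minus (Teps eps t u) (Teps eps (INR n * h) u),
  minus (T (INR n * h) u) (Nat.iter n (resolvent A h) u),
  minus (Teps eps (INR n * h) u) (Nat.iter n (resolvent A h) u)); lra.
Qed.

End TrotterKato.

(** * One-sided derivatives *)

Lemma continuous_nonexpansive (F : R -> R) x :
  (forall y, Rabs (F y - F x) <= Rabs (y - x)) -> continuous F x.
Proof.
intros H P [e He]; exists e; intros y Hy; apply He.
change (Rabs (F y - F x) < e); apply Rle_lt_trans with (1 := H y), Hy.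
Qed.

Lemma continuous_Rmin k x : continuous (fun y => Rmin y k) x.
Proof.
apply continuous_nonexpansive; intros y.
unfold Rmin, Rabs; repeat destruct Rle_dec; repeat destruct Rcase_abs; lra.
Qed.

Lemma continuous_Rmax k x : continuous (fun y => Rmax y k) x.
Proof.
apply continuous_nonexpansive; intros y.
unfold Rmax, Rabs; repeat destruct Rle_dec; repeat destruct Rcase_abs; lra.
Qed.

Lemma Cont_of_continuous {a b : R} (F : R -> R) : (forall x, continuous F x) ->
  exists f : Cont a b, forall x, Icc a b x -> f x = F x.
Proof.
intros HF.
pose (F0 := fun x => if excluded_middle_informative (Icc a b x) then F x else 0).
assert (E : forall x, Icc a b x -> F0 x = F x).
{ intros x Hx; unfold F0; destruct excluded_middle_informative; tauto. }
assert (C1 : continuous_on (Icc a b) F0).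
{ apply (continuous_on_ext (Icc a b) F); [intros x Hx; symmetry; now apply E|].
  apply continuous_on_forall; intros; apply HF. }
assert (C0 : forall x, ~ Icc a b x -> F0 x = 0).
{ intros x Hx; unfold F0; destruct excluded_middle_informative; tauto. }
now exists (mkC F0 C1 C0).
Qed.

(** On the whole line, primitives have two-sided derivatives everywhere. Constancy beyond the ends
    is what makes the second differences vanish at [a] and [b] in [A_lim_dense]. *)
Lemma Cont_extension {a b : R} (f : Cont a b) : a <= b ->
  exists F : R -> R, (forall x, continuous F x) /\
    (forall x, Icc a b x -> F x = f x) /\
    (forall x, x <= a -> F x = f a) /\ (forall x, b <= x -> F x = f b).
Proof.
intros Hab.
pose (cl := fun x => Rmax (Rmin x b) a).
assert (clI : forall x, Icc a b (cl x)).
{ intros x; unfold cl, Icc, Rmax, Rmin; repeat destruct Rle_dec; lra. }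
exists (fun x => f (cl x)); split; [|split; [|split]].
- intros x.
  apply (filterlim_comp _ _ _ cl f _ (within (Icc a b) (locally (cl x)))).
  2: now apply cfun_cont.
  assert (C : continuous cl x).
  { apply (continuous_comp (fun y => Rmin y b) (fun y => Rmax y a));
      [apply continuous_Rmin|apply continuous_Rmax]. }
  intros P HP; generalize (C _ HP); unfold filtermap.
  apply filter_imp; intros y Hy; apply Hy, clI.
- intros x Hx; f_equal; unfold cl, Icc, Rmax, Rmin in *; repeat destruct Rle_dec; lra.
- intros x Hx; f_equal; unfold cl, Icc, Rmax, Rmin in *; repeat destruct Rle_dec; lra.
- intros x Hx; f_equal; unfold cl, Icc, Rmax, Rmin in *; repeat destruct Rle_dec; lra.
Qed.

Lemma primitive_exists (g : R -> R) : (forall x, continuous g x) ->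
  exists G : R -> R, G 0 = 0 /\ forall x, is_derive G x (g x).
Proof.
intros Hg; exists (fun x => RInt g 0 x); split; [exact (RInt_point 0 g)|]; intros x.
apply (is_derive_RInt g _ 0); [|apply Hg].
apply filter_forall; intros y.
apply (RInt_correct (V := R_CompleteNormedModule)), ex_RInt_continuous; intros; apply Hg.
Qed.

Lemma is_derive_continuous (F : R -> R) x l : is_derive F x l -> continuous F x.
Proof.
intros H; apply (ex_derive_continuous (V := R_NormedModule)); now exists l.
Qed.

Lemma D_in_of_is_derive (D : R -> Prop) (F F1 f : R -> R) x :
  D x -> (forall y, D y -> f y = F y) -> is_derive F x (F1 x) -> D_in f F1 D x.
Proof.
intros Hx E H; apply is_derive_Reals in H.
intros eps Heps; destruct (H eps Heps) as [d Hd].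
exists d; split; [apply cond_pos|]; intros y [[Hy Hne] Hdist].
simpl in *; unfold Rdist in *.
rewrite !E by assumption.
generalize (Hd (y - x) ltac:(lra) Hdist).
now replace (x + (y - x)) with y by ring.
Qed.

Lemma C2_on_intro p q (F F1 F2 f : R -> R) :
  (forall x, is_derive F x (F1 x)) -> (forall x, is_derive F1 x (F2 x)) ->
  (forall x, continuous F2 x) -> (forall x, Icc p q x -> f x = F x) ->
  C2_on p q f F1 F2.
Proof.
intros H1 H2 H3 E; split; [|split].
- intros x Hx; now apply D_in_of_is_derive with F.
- intros x Hx; now apply D_in_of_is_derive with F1.
- apply continuous_on_forall; intros; apply H3.
Qed.

Lemma C2_on_plus p q f f1 f2 g g1 g2 : C2_on p q f f1 f2 -> C2_on p q g g1 g2 ->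
  C2_on p q (fun x => f x + g x) (fun x => f1 x + g1 x) (fun x => f2 x + g2 x).
Proof.
intros [H1 [H2 H3]] [K1 [K2 K3]]; split; [|split].
- intros x Hx; now apply Dadd; auto.
- intros x Hx; now apply Dadd; auto.
- intros x Hx.
  apply (filterlim_comp_2 (G := locally (f2 x)) (H := locally (g2 x))); auto.
  apply (@filterlim_plus R_AbsRing R_NormedModule).
Qed.

Lemma C2_on_scal p q k f f1 f2 : C2_on p q f f1 f2 ->
  C2_on p q (fun x => k * f x) (fun x => k * f1 x) (fun x => k * f2 x).
Proof.
intros [H1 [H2 H3]]; split; [|split].
- intros x Hx; now apply Dmult_const; auto.
- intros x Hx; now apply Dmult_const; auto.
- intros x Hx.
  apply (filterlim_comp _ _ _ f2 (fun y => k * y) _ (locally (f2 x))); auto.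
  apply (@filterlim_scal_r R_AbsRing R_NormedModule).
Qed.

(** Values of [f] outside [p,q] are arbitrary, so the classical mean value theorem is applied to [f]
    composed with the clamp onto [x,y], which is continuous everywhere and agrees with [f] near
    interior points. *)
Lemma D_in_MVT p q f f1 x y :
  (forall z, Icc p q z -> D_in f f1 (Icc p q) z) -> p <= x -> x < y -> y <= q ->
  exists z, x < z < y /\ f y - f x = f1 z * (y - x).
Proof.
intros H Hpx Hxy Hyq.
pose (cl := fun z => Rmax (Rmin z y) x).
assert (clI : forall z, x <= cl z <= y).
{ intros z; unfold cl, Rmax, Rmin; repeat destruct Rle_dec; lra. }
assert (clid : forall z, x <= z <= y -> cl z = z).
{ intros z; unfold cl, Rmax, Rmin; repeat destruct Rle_dec; lra. }
assert (cllip : forall z c, Rabs (cl z - cl c) <= Rabs (z - c)).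
{ intros z c; unfold cl, Rmax, Rmin, Rabs.
  repeat destruct Rle_dec; repeat destruct Rcase_abs; lra. }
assert (D : forall c, x < c < y -> derivable_pt_lim (fun z => f (cl z)) c (f1 c)).
{ intros c Hc eps Heps.
  destruct (H c ltac:(unfold Icc; lra) eps Heps) as [alp [Ha Hlim]].
  assert (Hd : 0 < Rmin alp (Rmin (c - x) (y - c))).
  { repeat apply Rmin_glb_lt; lra. }
  exists (mkposreal _ Hd); intros h Hh Hhd; simpl in Hhd.
  assert (K1 := Rmin_l alp (Rmin (c - x) (y - c))).
  assert (K2 := Rmin_r alp (Rmin (c - x) (y - c))).
  assert (K3 := Rmin_l (c - x) (y - c)).
  assert (K4 := Rmin_r (c - x) (y - c)).
  assert (B : - (c - x) < h < y - c).
  { revert Hhd; unfold Rabs; destruct Rcase_abs; lra. }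
  rewrite !clid by lra.
  specialize (Hlim (c + h)); simpl in Hlim; unfold Rdist in Hlim.
  replace (c + h - c) with h in Hlim by ring.
  apply Hlim; split; [split; [unfold Icc; lra|lra]|lra]. }
destruct (MVT (fun z => f (cl z)) id x y
  (fun c Hc => exist _ (f1 c) (D c Hc)) (fun c _ => derivable_pt_id c) Hxy)
  as [z [Hz E]].
- intros c Hc.
  assert (Hcl : Icc p q (cl c)) by (generalize (clI c); unfold Icc; lra).
  intros eps Heps.
  destruct (cont_deriv f f1 (Icc p q) (cl c) (H _ Hcl) eps Heps) as [alp [Ha Hlim]].
  exists alp; split; [exact Ha|]; intros z [_ Hz].
  destruct (Req_dec (cl z) (cl c)) as [Ez|Ez].
  + simpl; unfold Rdist; rewrite Ez, Rminus_diag, Rabs_R0; exact Heps.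
  + apply Hlim; split.
    * split; [generalize (clI z); unfold Icc; lra|congruence].
    * simpl in *; unfold Rdist in *; generalize (cllip z c); lra.
- intros c _; apply derivable_continuous_pt, derivable_pt_id.
- exists z; split; [exact Hz|].
  rewrite derive_pt_id in E.
  assert (E1 : derive_pt (fun z => f (cl z)) z (exist _ (f1 z) (D z Hz)) = f1 z)
    by (apply derive_pt_eq_0, D, Hz).
  rewrite E1, !clid in E by lra; unfold id in E; lra.
Qed.

Lemma left_min_derivative p q f f1 x0 : D_in f f1 (Icc p q) x0 -> p < x0 <= q ->
  (forall x, Icc p q x -> f x0 <= f x) -> f1 x0 <= 0.
Proof.
intros HD Hx0 Hm; apply Rnot_lt_le; intros Hpos.
destruct (HD (f1 x0) Hpos) as [alp [Ha Hlim]].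
set (z := Rmax p (x0 - alp / 2)).
assert (Hz : p <= z < x0 /\ x0 - z < alp).
{ unfold z, Rmax; destruct Rle_dec; lra. }
specialize (Hm z ltac:(unfold Icc; lra)).
specialize (Hlim z); simpl in Hlim; unfold Rdist in Hlim.
assert (K : Rabs ((f z - f x0) / (z - x0) - f1 x0) < f1 x0).
{ apply Hlim; split; [split; [unfold Icc; lra|lra]|].
  unfold Rabs; destruct Rcase_abs; lra. }
assert ((f z - f x0) / (z - x0) <= 0).
{ replace ((f z - f x0) / (z - x0)) with (- ((f z - f x0) * / (x0 - z))) by (field; lra).
  assert (0 < / (x0 - z)) by (apply Rinv_0_lt_compat; lra).
  nra. }
revert K; unfold Rabs; destruct Rcase_abs; lra.
Qed.

(** If [f2 x0 < 0], then [f1 < 0] just to the right of [x0] and [f] drops below its minimum. Asking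
    for [f1 x0 <= 0] instead of a vanishing derivative makes the test valid at the left end of an
    interval, in particular at the kink. *)
Lemma right_min_second_derivative p q f f1 f2 x0 : C2_on p q f f1 f2 -> p <= x0 < q ->
  f1 x0 <= 0 -> (forall x, Icc p q x -> f x0 <= f x) -> 0 <= f2 x0.
Proof.
intros [H1 [H2 _]] Hx0 Hf1 Hm; apply Rnot_lt_le; intros Hneg.
destruct (H2 x0 ltac:(unfold Icc; lra) (- f2 x0) ltac:(lra)) as [alp [Ha Hlim]].
set (y := Rmin q (x0 + alp / 2)).
assert (Hy : x0 < y <= q /\ y - x0 < alp).
{ unfold y, Rmin; destruct Rle_dec; lra. }
destruct (D_in_MVT p q f f1 x0 y H1) as [z [Hz E]]; try lra.
specialize (Hm y ltac:(unfold Icc; lra)).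
specialize (Hlim z); simpl in Hlim; unfold Rdist in Hlim.
assert (K : Rabs ((f1 z - f1 x0) / (z - x0) - f2 x0) < - f2 x0).
{ apply Hlim; split; [split; [unfold Icc; lra|lra]|].
  rewrite Rabs_pos_eq; lra. }
assert (Q : (f1 z - f1 x0) / (z - x0) < 0).
{ revert K; unfold Rabs; destruct Rcase_abs; lra. }
assert (f1 z < 0).
{ replace (f1 z) with ((f1 z - f1 x0) / (z - x0) * (z - x0) + f1 x0) by (field; lra).
  nra. }
nra.
Qed.

(** * The limit operator *)

Lemma A_lim_intro (a b gamma : R) (L L1 L2 Q Q1 Q2 : R -> R) : a < 0 < b ->
  (forall x, is_derive L x (L1 x)) -> (forall x, is_derive L1 x (L2 x)) ->
  (forall x, continuous L2 x) ->
  (forall x, is_derive Q x (Q1 x)) -> (forall x, is_derive Q1 x (Q2 x)) ->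
  (forall x, continuous Q2 x) ->
  L 0 = Q 0 -> L2 0 = Q2 0 -> L2 a = 0 -> Q2 b = 0 -> Q1 0 - L1 0 = 2 * gamma * Q 0 ->
  exists f g : Cont a b, A_lim a b gamma f g /\
    (forall x, Icc a 0 x -> f x = L x /\ g x = / 2 * L2 x) /\
    (forall x, Icc 0 b x -> f x = Q x /\ g x = / 2 * Q2 x).
Proof.
intros Hab HL HL1 HL2 HQ HQ1 HQ2 E0 E2 La Qb J.
pose (glue := fun (F G : R -> R) x => F (Rmin x 0) + G (Rmax x 0) - F 0).
assert (Cg : forall F G : R -> R, (forall x, continuous F x) -> (forall x, continuous G x) ->
  forall x, continuous (glue F G) x).
{ intros F G HF HG x.
  apply (continuous_minus (V := R_NormedModule)); [|apply continuous_const].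
  apply (continuous_plus (V := R_NormedModule)).
  - apply (continuous_comp (fun y => Rmin y 0) F); [apply continuous_Rmin|apply HF].
  - apply (continuous_comp (fun y => Rmax y 0) G); [apply continuous_Rmax|apply HG]. }
assert (gl : forall F G : R -> R, F 0 = G 0 -> forall x, x <= 0 -> glue F G x = F x).
{ intros F G E x Hx; unfold glue; rewrite Rmin_left, Rmax_right by lra; lra. }
assert (gr : forall F G : R -> R, F 0 = G 0 -> forall x, 0 <= x -> glue F G x = G x).
{ intros F G E x Hx; unfold glue; rewrite Rmin_right, Rmax_left by lra; lra. }
destruct (Cont_of_continuous (a := a) (b := b) (glue L Q)) as [f Hf].
{ apply Cg; intros x; eapply is_derive_continuous; auto. }
destruct (Cont_of_continuous (a := a) (b := b)
  (glue (fun x => / 2 * L2 x) (fun x => / 2 * Q2 x))) as [g Hg].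
{ apply Cg; intros x; apply (continuous_scal_r (V := R_NormedModule) (/ 2)); auto. }
assert (fl : forall x, Icc a 0 x -> f x = L x).
{ intros x Hx; rewrite Hf by (unfold Icc in *; lra); apply gl; unfold Icc in *; lra. }
assert (fr : forall x, Icc 0 b x -> f x = Q x).
{ intros x Hx; rewrite Hf by (unfold Icc in *; lra); apply gr; unfold Icc in *; lra. }
assert (gl' : forall x, Icc a 0 x -> g x = / 2 * L2 x).
{ intros x Hx; rewrite Hg by (unfold Icc in *; lra).
  rewrite gl; unfold Icc in *; lra. }
assert (gr' : forall x, Icc 0 b x -> g x = / 2 * Q2 x).
{ intros x Hx; rewrite Hg by (unfold Icc in *; lra).
  rewrite gr; unfold Icc in *; lra. }
exists f, g; split; [|split; intros x Hx; split; auto].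
exists L1, L2, Q1, Q2; repeat (split; [solve [auto | now apply C2_on_intro with L
  | now apply C2_on_intro with Q | rewrite fr by (unfold Icc; lra); exact J]|]).
exact gr'.
Qed.

Lemma A_lim_plus (a b gamma : R) (f f' g g' : Cont a b) :
  A_lim a b gamma f g -> A_lim a b gamma f' g' -> A_lim a b gamma (plus f f') (plus g g').
Proof.
intros [l1 [l2 [r1 [r2 [H1 [H2 [H3 [H4 [H5 [H6 [H7 H8]]]]]]]]]]].
intros [l1' [l2' [r1' [r2' [K1 [K2 [K3 [K4 [K5 [K6 [K7 K8]]]]]]]]]]].
exists (fun x => l1 x + l1' x), (fun x => l2 x + l2' x),
  (fun x => r1 x + r1' x), (fun x => r2 x + r2' x).
split; [now apply (C2_on_plus a 0 f l1 l2 f')|].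
split; [now apply (C2_on_plus 0 b f r1 r2 f')|].
repeat (split; [pointwise; lra|]).
split; intros x Hx; pointwise.
- rewrite H7, K7 by exact Hx; ring.
- rewrite H8, K8 by exact Hx; ring.
Qed.

Lemma A_lim_scal (a b gamma k : R) (f g : Cont a b) :
  A_lim a b gamma f g -> A_lim a b gamma (scal k f) (scal k g).
Proof.
intros [l1 [l2 [r1 [r2 [H1 [H2 [H3 [H4 [H5 [H6 [H7 H8]]]]]]]]]]].
exists (fun x => k * l1 x), (fun x => k * l2 x), (fun x => k * r1 x), (fun x => k * r2 x).
split; [now apply (C2_on_scal a 0 k f)|].
split; [now apply (C2_on_scal 0 b k f)|].
split; [rewrite H3; ring|].
split; [rewrite H4; ring|].
split; [rewrite H5; ring|].
split; [pointwise; rewrite <- Rmult_minus_distr_l, H6; ring|].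
split; intros x Hx; pointwise.
- rewrite H7 by exact Hx; ring.
- rewrite H8 by exact Hx; ring.
Qed.

(* At the kink, a nonpositive minimum has [f'(0-) <= 0] and
   [f'(0+) = f'(0-) + 2 gamma f(0) <= 0], so the one-sided test on [0,b] applies. *)
Lemma A_lim_min (a b gamma : R) (f g : Cont a b) x0 : a < 0 < b -> 0 <= gamma ->
  A_lim a b gamma f g -> Icc a b x0 ->
  (forall x, Icc a b x -> f x0 <= f x) -> f x0 <= 0 -> 0 <= g x0.
Proof.
intros Hab Hgam [l1 [l2 [r1 [r2 [H1 [H2 [H3 [H4 [H5 [H6 [H7 H8]]]]]]]]]]] Hx0 Hm Hneg.
unfold Icc in Hx0.
assert (Ml : forall x, Icc a 0 x -> f x0 <= f x)
  by (intros x Hx; apply Hm; unfold Icc in *; lra).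
assert (Mr : forall x, Icc 0 b x -> f x0 <= f x)
  by (intros x Hx; apply Hm; unfold Icc in *; lra).
destruct (Req_dec x0 a) as [->|Ha].
{ rewrite H7, H3 by (unfold Icc; lra); lra. }
destruct (Req_dec x0 b) as [->|Hb].
{ rewrite H8, H4 by (unfold Icc; lra); lra. }
destruct (Rlt_le_dec x0 0) as [Hlt|Hge].
- rewrite H7 by (unfold Icc; lra).
  assert (l1 x0 <= 0).
  { apply (left_min_derivative a 0 f); [|lra|exact Ml].
    apply (proj1 H1); unfold Icc; lra. }
  assert (0 <= l2 x0) by (apply (right_min_second_derivative a 0 f l1); auto; lra).
  lra.
- rewrite H8 by (unfold Icc; lra).
  assert (r1 x0 <= 0).
  { destruct (Req_dec x0 0) as [->|H0].
    - assert (l1 0 <= 0).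
      { apply (left_min_derivative a 0 f); [|lra|exact Ml].
        apply (proj1 H1); unfold Icc; lra. }
      nra.
    - apply (left_min_derivative 0 b f); [|lra|exact Mr].
      apply (proj1 H2); unfold Icc; lra. }
  assert (0 <= r2 x0) by (apply (right_min_second_derivative 0 b f r1); auto; lra).
  lra.
Qed.

(** * Solving the resolvent equation of the limit operator *)

Lemma hyperbolic_pair w : 0 < w -> exists C S : R -> R,
  (forall x, is_derive C x (w * S x)) /\ (forall x, is_derive S x (w * C x)) /\
  (forall x, C x * C x - S x * S x = 1) /\ (forall x, 0 < C x) /\ C 0 = 1 /\ S 0 = 0 /\
  (forall x, 0 < x -> 0 < S x) /\ (forall x, x < 0 -> S x < 0).
Proof.
intros Hw; exists (fun x => cosh (w * x)), (fun x => sinh (w * x)).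
unfold cosh, sinh.
assert (Hp : forall x, 0 < x -> exp (- (w * x)) < exp (w * x)).
{ intros x Hx; apply exp_increasing; nra. }
assert (Hn : forall x, x < 0 -> exp (w * x) < exp (- (w * x))).
{ intros x Hx; apply exp_increasing; nra. }
split; [|split; [|split; [|split; [|split; [|split; [|split]]]]]].
- intros x; auto_derive; [exact I|field].
- intros x; auto_derive; [exact I|field].
- intros x; rewrite exp_Ropp; field; apply Rgt_not_eq, exp_pos.
- intros x; generalize (exp_pos (w * x)) (exp_pos (- (w * x))); lra.
- rewrite Rmult_0_r, Ropp_0, exp_0; field.
- rewrite Rmult_0_r, Ropp_0, exp_0; field.
- intros x Hx; generalize (Hp x Hx); lra.
- intros x Hx; generalize (Hn x Hx); lra.
Qed.

(* Variation of constants for [f'' = (2 / h) (f - k)], whose homogeneous solutions are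
   spanned by [cosh (w x)] and [sinh (w x)] with [w^2 = 2 / h]. *)
Lemma A_lim_range (a b gamma h : R) (k : Cont a b) : a < 0 < b -> 0 <= gamma -> 0 < h ->
  exists f g : Cont a b, A_lim a b gamma f g /\ minus f (scal h g) = k.
Proof.
intros Hab Hgam Hh.
destruct (Cont_extension k) as [g [Hg [Eg _]]]; [lra|].
set (w := sqrt (2 / h)).
assert (H2h : 0 < 2 / h) by (apply Rdiv_lt_0_compat; lra).
assert (Hw : 0 < w) by now apply sqrt_lt_R0.
assert (Ew : w * w = 2 / h) by (apply sqrt_sqrt; lra).
destruct (hyperbolic_pair w Hw) as [C [S [HC [HS [HCS [Cpos [C0 [S0 [Spos Sneg]]]]]]]]].
assert (HCc : forall x, continuous C x) by (intros; eapply is_derive_continuous; apply HC).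
assert (HSc : forall x, continuous S x) by (intros; eapply is_derive_continuous; apply HS).
destruct (primitive_exists (fun x => C x * g x)) as [P [P0 HP]].
{ intros x; apply (continuous_mult (K := R_AbsRing)); auto. }
destruct (primitive_exists (fun x => S x * g x)) as [Q [Q0 HQ]].
{ intros x; apply (continuous_mult (K := R_AbsRing)); auto. }
(* By the addition formula [p x] is [- w] times the integral of [sinh (w (x - y)) g y] over y from 0
   to x: the particular solution with zero value and slope at 0. [F al be] is the general
   solution. *)
pose (p := fun x => - w * (S x * P x - C x * Q x)).
pose (F := fun al be x => p x + al * C x + be * S x).
pose (F1 := fun al be x => - (w * w) * (C x * P x - S x * Q x) + al * (w * S x) + be * (w * C x)).
pose (F2 := fun al be x => w * w * (F al be x - g x)).
assert (DC : forall x, ex_derive C x) by (intros; eexists; apply HC).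
assert (DS : forall x, ex_derive S x) by (intros; eexists; apply HS).
assert (DP : forall x, ex_derive P x) by (intros; eexists; apply HP).
assert (DQ : forall x, ex_derive Q x) by (intros; eexists; apply HQ).
assert (HF : forall al be x, is_derive (F al be) x (F1 al be x)).
{ intros al be x; unfold F, p, F1; auto_derive; [repeat split; auto|].
  change (Derive (fun x => C x) x) with (Derive C x).
  change (Derive (fun x => S x) x) with (Derive S x).
  change (Derive (fun x => P x) x) with (Derive P x).
  change (Derive (fun x => Q x) x) with (Derive Q x).
  rewrite (is_derive_unique C _ _ (HC x)), (is_derive_unique S _ _ (HS x)),
    (is_derive_unique P _ _ (HP x)), (is_derive_unique Q _ _ (HQ x)); ring. }
assert (HF1 : forall al be x, is_derive (F1 al be) x (F2 al be x)).
{ intros al be x; unfold F2, F, p, F1; auto_derive; [repeat split; auto|].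
  change (Derive (fun x => C x) x) with (Derive C x).
  change (Derive (fun x => S x) x) with (Derive S x).
  change (Derive (fun x => P x) x) with (Derive P x).
  change (Derive (fun x => Q x) x) with (Derive Q x).
  rewrite (is_derive_unique C _ _ (HC x)), (is_derive_unique S _ _ (HS x)),
    (is_derive_unique P _ _ (HP x)), (is_derive_unique Q _ _ (HQ x)).
  transitivity (w * w * (- w * (S x * P x - C x * Q x) + al * C x + be * S x
    - (C x * C x - S x * S x) * g x)); [ring|rewrite HCS; ring]. }
assert (HF2 : forall al be x, continuous (F2 al be) x).
{ intros al be x; unfold F2.
  apply (continuous_scal_r (V := R_NormedModule) (w * w)).
  apply (continuous_minus (V := R_NormedModule)); [|apply Hg].
  eapply is_derive_continuous; apply HF. }
assert (Sa := Sneg a (proj1 Hab)); assert (Sb := Spos b (proj2 Hab)).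
(* A vanishing second derivative at the ends means [F = g] there, which gives [bl] and [br] in terms
   of the common value [al] at 0. The jump condition [w (br - bl) = 2 gamma al] becomes
   [al D = w K], and [D > 0] because [0 <= gamma] and [S a < 0 < S b]. *)
set (K := (g b - p b) / S b - (g a - p a) / S a).
set (D := 2 * gamma + w * (C b / S b - C a / S a)).
assert (HD : 0 < D).
{ assert (0 < C b / S b) by now apply Rdiv_lt_0_compat.
  assert (0 < C a / - S a) by (apply Rdiv_lt_0_compat; [apply Cpos|lra]).
  assert (0 < w * (C b / S b + C a / - S a)) by (apply Rmult_lt_0_compat; lra).
  unfold D; replace (C a / S a) with (- (C a / - S a)) by (field; lra); lra. }
set (al := w * K / D).
set (bl := (g a - p a - al * C a) / S a).
set (br := (g b - p b - al * C b) / S b).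
assert (p0 : p 0 = 0) by (unfold p; rewrite P0, Q0; ring).
assert (Fl0 : F al bl 0 = al) by (unfold F; rewrite p0, C0, S0; ring).
assert (Fr0 : F al br 0 = al) by (unfold F; rewrite p0, C0, S0; ring).
destruct (A_lim_intro a b gamma (F al bl) (F1 al bl) (F2 al bl)
  (F al br) (F1 al br) (F2 al br)) as [f [f' [Hf [Hl Hr]]]]; auto.
- now rewrite Fl0.
- unfold F2; now rewrite Fl0, Fr0.
- unfold F2; replace (F al bl a) with (g a); [ring|unfold F, bl; field; lra].
- unfold F2; replace (F al br b) with (g b); [ring|unfold F, br; field; lra].
- assert (EK : w * K = al * D) by (unfold al; field; lra).
  unfold F1; rewrite Fr0, P0, Q0, C0, S0.
  transitivity (w * (br - bl)); [ring|].
  replace (br - bl) with (K - al * (C b / S b - C a / S a))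
    by (unfold br, bl, K; field; lra).
  rewrite Rmult_minus_distr_l, EK; unfold D; ring.
- exists f, f'; split; [exact Hf|]; apply C_ext; intros x Hx; pointwise.
  assert (Eh : h * (w * w) = 2) by (rewrite Ew; field; lra).
  destruct (Rle_lt_dec x 0) as [Hx0|Hx0].
  + destruct (Hl x) as [-> ->]; [unfold Icc in *; lra|].
    unfold F2; rewrite <- (Eg x Hx).
    replace (h * (/ 2 * (w * w * (F al bl x - g x))))
      with (h * (w * w) * (/ 2 * (F al bl x - g x))) by ring.
    rewrite Eh; field.
  + destruct (Hr x) as [-> ->]; [unfold Icc in *; lra|].
    unfold F2; rewrite <- (Eg x Hx).
    replace (h * (/ 2 * (w * w * (F al br x - g x))))
      with (h * (w * w) * (/ 2 * (F al br x - g x))) by ring.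
    rewrite Eh; field.
Qed.

(** * Density of the domain of the limit operator *)

Lemma is_derive_MVT (F F1 : R -> R) x y : (forall z, is_derive F z (F1 z)) -> x < y ->
  exists z, x <= z <= y /\ F y - F x = F1 z * (y - x).
Proof.
intros HF Hxy.
destruct (MVT_gen F x y F1) as [z [Hz E]].
- intros z _; apply HF.
- intros z _; apply continuity_pt_filterlim, (is_derive_continuous F z (F1 z)), HF.
- rewrite Rmin_left, Rmax_right in Hz by lra; now exists z.
Qed.

(* [u] is the second difference quotient of a second primitive of [g]. *)
Lemma steklov_smoothing (g : R -> R) h : (forall x, continuous g x) -> 0 < h ->
  exists u u1 : R -> R, (forall x, is_derive u x (u1 x)) /\
    (forall x, is_derive u1 x ((g (x + 2 * h) - 2 * g (x + h) + g x) / (h * h))) /\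
    (forall x, exists y, x <= y <= x + 2 * h /\ u x = g y).
Proof.
intros Hg Hh.
destruct (primitive_exists g Hg) as [G1 [_ HG1]].
destruct (primitive_exists G1) as [G2 [_ HG2]].
{ intros x; eapply is_derive_continuous; apply HG1. }
assert (D : forall F F1 : R -> R, (forall x, is_derive F x (F1 x)) -> forall x,
  is_derive (fun x => (F (x + 2 * h) - 2 * F (x + h) + F x) / (h * h)) x
    ((F1 (x + 2 * h) - 2 * F1 (x + h) + F1 x) / (h * h))).
{ intros F F1 HF x.
  assert (DF : forall x, ex_derive F x) by (intros; eexists; apply HF).
  auto_derive; [repeat split; auto|].
  change (Derive (fun x => F x)) with (Derive F).
  rewrite !(is_derive_unique F _ _ (HF _)); unfold Rdiv; ring. }
exists (fun x => (G2 (x + 2 * h) - 2 * G2 (x + h) + G2 x) / (h * h)),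
  (fun x => (G1 (x + 2 * h) - 2 * G1 (x + h) + G1 x) / (h * h)).
split; [now apply D|split; [now apply D|]]; intros x.
assert (HK : forall y, is_derive (fun y => G2 (y + h) - G2 y) y (G1 (y + h) - G1 y)).
{ intros y.
  assert (DF : forall x, ex_derive G2 x) by (intros; eexists; apply HG2).
  auto_derive; [repeat split; auto|].
  change (Derive (fun x => G2 x)) with (Derive G2).
  rewrite !(is_derive_unique G2 _ _ (HG2 _)); ring. }
destruct (is_derive_MVT _ _ x (x + h) HK) as [y [Hy E]]; [lra|].
destruct (is_derive_MVT _ _ y (y + h) HG1) as [z [Hz E']]; [lra|].
exists z; split; [lra|].
rewrite E' in E.
replace (x + h + h) with (x + 2 * h) in E by ring.
apply Rmult_eq_reg_r with (h * h); [|nra].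
transitivity (G2 (x + 2 * h) - 2 * G2 (x + h) + G2 x); [field; lra|].
nra.
Qed.

(** Adding a multiple of [s] on [0,b] produces any jump of the first derivative at 0 at small
    uniform cost, without changing the second derivative at 0 and [b]. The function is
    [d sin (x / d)] with [d = b / (PI n)] and [n] a large integer. *)
Lemma kink_function b e : 0 < b -> 0 < e -> exists s s1 s2 : R -> R,
  (forall x, is_derive s x (s1 x)) /\ (forall x, is_derive s1 x (s2 x)) /\
  (forall x, continuous s2 x) /\ s 0 = 0 /\ s1 0 = 1 /\ s2 0 = 0 /\ s2 b = 0 /\
  forall x, Rabs (s x) <= e.
Proof.
intros Hb He.
assert (HPI := PI_RGT_0).
destruct (nfloor_ex (b / (PI * e))) as [m [_ Hm]].
{ apply Rlt_le, Rdiv_lt_0_compat; nra. }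
assert (Hm0 := pos_INR m).
set (n := INR m + 1) in *.
assert (Hn : 0 < n) by (unfold n; lra).
set (d := b / (PI * n)).
assert (Hd : 0 < d) by (apply Rdiv_lt_0_compat; nra).
assert (Hde : d <= e).
{ apply Rmult_le_reg_r with (PI * n / e); [apply Rdiv_lt_0_compat; nra|].
  unfold d; field_simplify; [|lra|nra].
  apply Rmult_lt_compat_r with (r := PI) in Hm; [|lra].
  replace (b / (PI * e) * PI) with (b / e) in Hm by (field; lra); lra. }
assert (Hsin : sin (/ d * b) = 0).
{ apply sin_eq_0_1; exists (Z.of_nat (S m)).
  rewrite <- INR_IZR_INZ, S_INR; fold n; unfold d; field; lra. }
exists (fun x => d * sin (/ d * x)), (fun x => cos (/ d * x)), (fun x => - / d * sin (/ d * x)).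
split; [|split; [|split; [|split; [|split; [|split; [|split]]]]]].
- intros x; auto_derive; [exact I|field; lra].
- intros x; auto_derive; [exact I|field; lra].
- intros x; apply (is_derive_continuous _ x (- / d * (/ d * cos (/ d * x)))).
  auto_derive; [exact I|field; lra].
- rewrite Rmult_0_r, sin_0; ring.
- rewrite Rmult_0_r; apply cos_0.
- rewrite Rmult_0_r, sin_0; ring.
- rewrite Hsin; ring.
- intros x; rewrite Rabs_mult, (Rabs_pos_eq d) by lra.
  assert (Rabs (sin (/ d * x)) <= 1) by (apply Rabs_le, SIN_bound).
  nra.
Qed.

(* Stretching the argument makes the function constant near both ends, so its
   smoothing has vanishing second derivative there; the kink is added on the right. *)
Lemma A_lim_dense (a b gamma : R) (f : Cont a b) e : a < 0 < b -> 0 < e ->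
  exists u v : Cont a b, A_lim a b gamma u v /\ norm (minus u f) <= e.
Proof.
intros Hab He.
destruct (Cont_extension f) as [F [HF [Ef [Fl Fr]]]]; [lra|].
assert (He2 : 0 < e / 2) by lra.
destruct (Heine F (Icc (a - 1) (b + 1)) (compact_P3 _ _)
  (fun x _ => proj2 (continuity_pt_filterlim F x) (HF x)) (mkposreal _ He2)) as [d Hd].
assert (Hd0 := cond_pos d).
set (W := b - a).
(* The stretched point [(1 + eta) x] stays within [d / 4] of [x], where [d] is the modulus of
   uniform continuity, and within 1/2, so that smoothing remains inside [a-1,b+1]. *)
set (eta := Rmin (Rmin (d / 4) (1 / 2) / W) 1).
assert (HW : 0 < W) by (unfold W; lra).
assert (Heta : 0 < eta <= 1).
{ split; [|apply Rmin_r]; apply Rmin_glb_lt; [|lra].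
  apply Rdiv_lt_0_compat; [apply Rmin_glb_lt; lra|exact HW]. }
assert (HetaW : eta * W <= d / 4 /\ eta * W <= 1 / 2).
{ assert (X : eta * W <= Rmin (d / 4) (1 / 2)).
  { apply Rle_trans with (Rmin (d / 4) (1 / 2) / W * W); [|right; field; lra].
    apply Rmult_le_compat_r; [lra|apply Rmin_l]. }
  generalize (Rmin_l (d / 4) (1 / 2)) (Rmin_r (d / 4) (1 / 2)); lra. }
(* [4 h <= - eta a] keeps the nodes [(1 + eta) (a + j h)], j = 0, 1, 2, to the left of [a], where
   [F] is constant; at [b] the nodes lie to the right anyway. *)
set (h := Rmin (- eta * a / 4) (Rmin (d / 16) (1 / 8))).
assert (Hh : 0 < h) by (repeat apply Rmin_glb_lt; nra).
assert (Hh1 : h <= - eta * a / 4) by apply Rmin_l.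
assert (Hh2 : h <= d / 16) by (eapply Rle_trans; [apply Rmin_r|apply Rmin_l]).
assert (Hh3 : h <= 1 / 8) by (eapply Rle_trans; [apply Rmin_r|apply Rmin_r]).
assert (HFs : forall x, continuous (fun x => F ((1 + eta) * x)) x).
{ intros x; apply (continuous_comp (fun x => (1 + eta) * x) F); [|apply HF].
  apply (continuous_scal_r (V := R_NormedModule) (1 + eta) (fun x => x)), continuous_id. }
destruct (steklov_smoothing _ h HFs Hh) as [u [u1 [Hu [Hu1 Hval]]]].
set (u2 := fun x => (F ((1 + eta) * (x + 2 * h)) - 2 * F ((1 + eta) * (x + h))
  + F ((1 + eta) * x)) / (h * h)) in *.
assert (Hu2 : forall x, continuous u2 x).
{ intros x; unfold u2, Rdiv.
  assert (X : forall c, continuous (fun x => F ((1 + eta) * (x + c))) x).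
  { intros c; apply (continuous_comp (fun x => (1 + eta) * (x + c)) F); [|apply HF].
    apply (continuous_scal_r (V := R_NormedModule) (1 + eta) (fun x => x + c)).
    apply (continuous_plus (V := R_NormedModule)); [apply continuous_id|apply continuous_const]. }
  apply (continuous_mult (K := R_AbsRing)); [|apply continuous_const].
  apply (continuous_plus (V := R_NormedModule)).
  - apply (continuous_minus (V := R_NormedModule)); [apply X|].
    apply (continuous_scal_r (V := R_NormedModule) 2), X.
  - apply (continuous_ext (fun x => F ((1 + eta) * (x + 0)))); [|apply X].
    intros y; now rewrite Rplus_0_r. }
assert (Happ : forall x, Icc a b x -> Rabs (u x - f x) <= e / 2).
{ intros x Hx; destruct (Hval x) as [y [Hy ->]]; rewrite <- (Ef x Hx).
  unfold Icc in Hx; unfold W in *.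
  assert (Bx : - (eta * (b - a)) <= eta * x <= eta * (b - a)) by nra.
  assert (By : 0 <= (1 + eta) * (y - x) <= 4 * h) by nra.
  apply Rlt_le, Hd; unfold Icc; try lra.
  apply Rle_lt_trans with (d / 2); [|lra]; apply Rabs_le; nra. }
destruct (kink_function b (e / 2 / (1 + Rabs (2 * gamma * u 0))))
  as [s [s1 [s2 [Hs [Hs1 [Hs2 [s0 [s10 [s20 [s2b Hsm]]]]]]]]]]; [lra| |].
{ apply Rdiv_lt_0_compat; [lra|]; generalize (Rabs_pos (2 * gamma * u 0)); lra. }
set (k := 2 * gamma * u 0) in *.
assert (Hk := Rabs_pos k).
assert (Hks : forall x, Rabs (k * s x) <= e / 2).
{ intros x; rewrite Rabs_mult.
  apply Rle_trans with ((1 + Rabs k) * (e / 2 / (1 + Rabs k))); [|right; field; lra].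
  apply Rmult_le_compat; [lra|apply Rabs_pos|lra|apply Hsm]. }
destruct (A_lim_intro a b gamma u u1 u2 (fun x => u x + k * s x)
  (fun x => u1 x + k * s1 x) (fun x => u2 x + k * s2 x)) as [f' [g' [H [Hl Hr]]]]; auto.
- intros x; apply (is_derive_plus (V := R_NormedModule)); [apply Hu|].
  apply (is_derive_scal s x k), Hs.
- intros x; apply (is_derive_plus (V := R_NormedModule)); [apply Hu1|].
  apply (is_derive_scal s1 x k), Hs1.
- intros x; apply (continuous_plus (V := R_NormedModule)); [apply Hu2|].
  apply (continuous_scal_r (V := R_NormedModule) k), Hs2.
- rewrite s0; ring.
- rewrite s20; ring.
- unfold u2; rewrite !Fl by nra; unfold Rdiv; ring.
- rewrite s2b; unfold u2; rewrite !Fr by nra; unfold Rdiv; ring.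
- rewrite s10, s0; unfold k; ring.
- exists f', g'; split; [exact H|].
  apply norm_le_intro; [lra|]; intros x Hx; pointwise.
  assert (B := Happ x Hx); apply Rabs_le_between in B.
  assert (B' := Hks x); apply Rabs_le_between in B'.
  destruct (Rle_lt_dec x 0) as [Hx0|Hx0].
  + rewrite (proj1 (Hl x ltac:(unfold Icc in *; lra))); lra.
  + rewrite (proj1 (Hr x ltac:(unfold Icc in *; lra))); lra.
Qed.

Lemma A_lim_pregenerator (a b gamma : R) : a < 0 < b -> 0 <= gamma ->
  Feller_pregenerator (A_lim a b gamma).
Proof.
intros Hab Hgam; split.
- intros; now apply A_lim_plus.
- intros; now apply A_lim_scal.
- intros f g x0 H; now apply (A_lim_min a b gamma).
- intros h k Hh; now apply A_lim_range.
- intros f e He; now apply A_lim_dense.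
Qed.

(** * Approximation of the domain of the limit operator *)

(** [G - F] and [G + F] are nondecreasing on [p,q] and vanish at 0, so |F| is at most [G] to the
    right of 0 and at most [- G] to the left. *)
Lemma primitive_domination (F F1 G G1 : R -> R) p q x :
  (forall y, is_derive F y (F1 y)) -> (forall y, is_derive G y (G1 y)) ->
  F 0 = 0 -> G 0 = 0 -> p <= 0 <= q ->
  (forall y, Icc p q y -> Rabs (F1 y) <= G1 y) -> Icc p q x -> Rabs (F x) <= Rabs (G x).
Proof.
intros HF HG F0 G0 Hpq H Hx.
assert (Dm : forall y, is_derive (fun y => G y - F y) y (G1 y - F1 y))
  by (intros; apply (is_derive_minus (V := R_NormedModule)); auto).
assert (Dp : forall y, is_derive (fun y => G y + F y) y (G1 y + F1 y))
  by (intros; apply (is_derive_plus (V := R_NormedModule)); auto).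
assert (B : forall y, Icc p q y -> 0 <= G1 y - F1 y /\ 0 <= G1 y + F1 y).
{ intros y Hy; generalize (H y Hy); unfold Rabs; destruct Rcase_abs; lra. }
unfold Icc in *.
destruct (Rtotal_order x 0) as [Hlt|[->|Hgt]].
- destruct (is_derive_MVT _ _ x 0 Dm Hlt) as [y [Hy E]].
  destruct (is_derive_MVT _ _ x 0 Dp Hlt) as [z [Hz E']].
  generalize (proj1 (B y ltac:(lra))) (proj2 (B z ltac:(lra))); intros.
  unfold Rabs; repeat destruct Rcase_abs; nra.
- rewrite F0, Rabs_R0; apply Rabs_pos.
- destruct (is_derive_MVT _ _ 0 x Dm Hgt) as [y [Hy E]].
  destruct (is_derive_MVT _ _ 0 x Dp Hgt) as [z [Hz E']].
  generalize (proj1 (B y ltac:(lra))) (proj2 (B z ltac:(lra))); intros.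
  unfold Rabs; repeat destruct Rcase_abs; nra.
Qed.

Lemma primitive_linear_bound (F F1 : R -> R) M p q x :
  (forall y, is_derive F y (F1 y)) -> F 0 = 0 -> p <= 0 <= q -> 0 <= M ->
  (forall y, Icc p q y -> Rabs (F1 y) <= M) -> Icc p q x -> Rabs (F x) <= M * Rabs x.
Proof.
intros HF F0 Hpq HM H Hx.
rewrite <- (Rabs_pos_eq M HM), <- Rabs_mult.
apply (primitive_domination F F1 (fun x => M * x) (fun _ => M) p q); auto; [|ring].
intros y; auto_derive; [exact I|ring].
Qed.

Lemma continuous_bounded (F : R -> R) p q : p <= q -> (forall x, continuous F x) ->
  exists M, 0 <= M /\ forall x, Icc p q x -> Rabs (F x) <= M.
Proof.
intros Hpq HF.
destruct (continuity_ab_maj (fun x => Rabs (F x)) p q Hpq) as [y [Hy _]].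
{ intros x _; apply continuity_pt_filterlim.
  apply (filterlim_comp _ _ _ F Rabs _ (locally (F x))); [apply HF|].
  apply (@filterlim_norm R_AbsRing R_NormedModule). }
exists (Rabs (F y)); split; [apply Rabs_pos|exact Hy].
Qed.

(** Beyond some [Z] the slope is at most [e] in absolute value; [C] bounds [F] on [0,Z]. *)
Lemma primitive_sublinear (F m : R -> R) : (forall x, is_derive F x (m x)) ->
  (forall e, 0 < e -> exists Z, forall z, Z <= z -> Rabs (m z) <= e) ->
  forall e, 0 < e -> exists C, forall z, 0 <= z -> Rabs (F z) <= C + e * z.
Proof.
intros HF Hm e He.
destruct (Hm e He) as [Z0 HZ0].
set (Z := Rmax Z0 0).
assert (HZ : Z0 <= Z /\ 0 <= Z) by (split; [apply Rmax_l|apply Rmax_r]).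
destruct (continuous_bounded F 0 Z) as [C [HC HCb]]; [lra| |].
{ intros x; eapply is_derive_continuous; apply HF. }
exists C; intros z Hz.
destruct (Rle_lt_dec z Z) as [Hle|Hgt].
- generalize (HCb z ltac:(unfold Icc; lra)); nra.
- destruct (is_derive_MVT F m Z z HF Hgt) as [y [Hy E]].
  assert (B := HCb Z ltac:(unfold Icc; lra)).
  assert (B' := HZ0 y ltac:(lra)).
  replace (F z) with (F Z + m y * (z - Z)) by lra.
  apply Rle_trans with (1 := Rabs_triang _ _); rewrite Rabs_mult, (Rabs_pos_eq (z - Z)) by lra.
  nra.
Qed.

Lemma primitive_sublinear_neg (F m : R -> R) : (forall x, is_derive F x (m x)) ->
  (forall e, 0 < e -> exists Z, forall z, z <= Z -> Rabs (m z) <= e) ->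
  forall e, 0 < e -> exists C, forall z, z <= 0 -> Rabs (F z) <= C + e * - z.
Proof.
intros HF Hm e He.
destruct (primitive_sublinear (fun z => F (- z)) (fun z => - m (- z))) with e as [C HC].
- intros x.
  assert (DF : forall x, ex_derive F x) by (intros; eexists; apply HF).
  auto_derive; [auto|].
  change (Derive (fun x => F x)) with (Derive F).
  rewrite (is_derive_unique F _ _ (HF _)); ring.
- intros e' He'; destruct (Hm e' He') as [Z HZ]; exists (- Z); intros z Hz.
  rewrite Rabs_Ropp; apply HZ; lra.
- exact He.
- exists C; intros z Hz.
  specialize (HC (- z) ltac:(lra)); rewrite Ropp_involutive in HC; exact HC.
Qed.

Lemma is_derive_rescale (F F1 : R -> R) eps x : (forall y, is_derive F y (F1 y)) ->
  is_derive (fun x => F (/ eps * x)) x (/ eps * F1 (/ eps * x)).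
Proof.
intros HF.
assert (DF : forall x, ex_derive F x) by (intros; eexists; apply HF).
auto_derive; [auto|].
change (Derive (fun x => F x)) with (Derive F).
rewrite (is_derive_unique F _ _ (HF _)); ring.
Qed.

Lemma is_derive_rescale_unit (F F1 : R -> R) eps x : eps <> 0 ->
  (forall y, is_derive F y (F1 y)) ->
  is_derive (fun x => eps * F (/ eps * x)) x (F1 (/ eps * x)).
Proof.
intros Heps HF.
replace (F1 (/ eps * x)) with (eps * (/ eps * F1 (/ eps * x))) by (field; exact Heps).
apply (is_derive_scal (fun x => F (/ eps * x)) x eps), is_derive_rescale, HF.
Qed.

Lemma at_right_0_lt d : 0 < d -> at_right 0 (fun eps => 0 < eps < d).
Proof.
intros Hd; exists (mkposreal d Hd); intros y Hy Hy0; split; [exact Hy0|].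
change (Rabs (y - 0) < d) in Hy; revert Hy; unfold Rabs; destruct Rcase_abs; lra.
Qed.

(** Rescaling turns [C + e' |z|] into [eps C + e' |x|]; with [e' = e / (2 (b - a))] the second term
    is at most [e / 2] on [a,b], and the first vanishes with eps. *)
Lemma rescaled_sublinear_small a b (H : R -> R) : a < 0 < b ->
  (forall e, 0 < e -> exists C, forall z, Rabs (H z) <= C + e * Rabs z) ->
  forall e, 0 < e -> at_right 0 (fun eps => forall x, Icc a b x ->
    Rabs (eps * H (/ eps * x)) <= e).
Proof.
intros Hab HH e He.
set (W := b - a).
assert (HW : 0 < W) by (unfold W; lra).
destruct (HH (e / 2 / W)) as [C HC]; [repeat apply Rdiv_lt_0_compat; lra|].
assert (HC1 := Rabs_pos C).
assert (Hd : 0 < e / 2 / (Rabs C + 1)) by (apply Rdiv_lt_0_compat; lra).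
generalize (at_right_0_lt _ Hd); apply filter_imp; intros eps Heps x Hx.
assert (Ha : Rabs x <= W) by (unfold Icc, W in *; apply Rabs_le; lra).
rewrite Rabs_mult, (Rabs_pos_eq eps) by lra.
assert (Hi : 0 < / eps) by (apply Rinv_0_lt_compat; lra).
assert (B := HC (/ eps * x)); rewrite Rabs_mult, (Rabs_pos_eq (/ eps)) in B by lra.
apply Rle_trans with (eps * C + e / 2 / W * Rabs x).
- replace (eps * C + e / 2 / W * Rabs x)
    with (eps * (C + e / 2 / W * (/ eps * Rabs x))) by (field; lra).
  apply Rmult_le_compat_l; lra.
- assert (e / 2 / W * Rabs x <= e / 2).
  { apply Rle_trans with (e / 2 / W * W); [|right; field; lra].
    apply Rmult_le_compat_l; [|exact Ha]; apply Rlt_le; repeat apply Rdiv_lt_0_compat; lra. }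
  assert (eps * (Rabs C + 1) <= e / 2).
  { apply Rle_trans with (e / 2 / (Rabs C + 1) * (Rabs C + 1)); [|right; field; lra].
    apply Rmult_le_compat_r; lra. }
  generalize (Rle_abs C); nra.
Qed.

(** * Asymptotics of the potential and construction of approximants *)

Section Potential.
Context (c : R -> R) (gamma : R).
Context (c_ge0 : forall x, 0 <= c x) (c_cont : forall x, continuous c x).

(** [gp] and [- gm] are the limits of [Phi] at plus and minus infinity. The integral hypothesis
    controls the joint limit of [Phi y - Phi x]; freezing [x] far to the left gives a Cauchy
    condition at plus infinity, and [gm] is then [gamma - gp]. *)
Lemma total_integral_split (Phi : R -> R) :
  is_RInt_gen c (Rbar_locally m_infty) (Rbar_locally p_infty) gamma ->
  (forall x, is_derive Phi x (c x)) -> Phi 0 = 0 ->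
  exists gp gm, 0 <= gp /\ 0 <= gm /\ gamma = gp + gm /\
    (forall z, - gm <= Phi z <= gp) /\
    (forall e, 0 < e -> exists Z, forall z, Z <= z -> Rabs (Phi z - gp) <= e) /\
    (forall e, 0 < e -> exists Z, forall z, z <= Z -> Rabs (Phi z + gm) <= e).
Proof.
intros c_int HPhi Phi0.
assert (K : forall e, 0 < e -> exists Z, 0 <= Z /\
  forall x y, x <= - Z -> Z <= y -> Rabs (Phi y - Phi x - gamma) <= e).
{ intros e He.
  destruct (c_int (fun v => Rabs (v - gamma) < e)) as [Q S [M1 HQ] [M2 HS] HQS].
  { exists (mkposreal e He); intros v Hv; exact Hv. }
  exists (Rabs M1 + Rabs M2 + 1); split.
  { generalize (Rabs_pos M1) (Rabs_pos M2); lra. }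
  intros x y Hx Hy.
  destruct (HQS x y) as [v [Hv1 Hv2]].
  - apply HQ; generalize (Rabs_pos M2); revert Hx; unfold Rabs; repeat destruct Rcase_abs; lra.
  - apply HS; generalize (Rabs_pos M1); revert Hy; unfold Rabs; repeat destruct Rcase_abs; lra.
  - simpl in Hv1.
    assert (E : is_RInt c x y (Phi y - Phi x))
      by (apply (is_RInt_derive (V := R_CompleteNormedModule)); intros; auto).
    rewrite <- (is_RInt_unique _ _ _ _ E), (is_RInt_unique _ _ _ _ Hv1).
    now apply Rlt_le. }
assert (Hmono : forall x y, x <= y -> Phi x <= Phi y).
{ intros x y Hxy; destruct (Rle_lt_or_eq_dec x y Hxy) as [H|<-]; [|lra].
  destruct (is_derive_MVT Phi c x y HPhi H) as [z [_ E]]; generalize (c_ge0 z); nra. }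
destruct (proj1 (filterlim_locally_cauchy (U := R_CompleteSpace)
  (F := Rbar_locally p_infty) Phi)) as [gp Hgp].
{ intros e; destruct (K (e / 4)) as [Z [HZ HK]]; [generalize (cond_pos e); lra|].
  exists (fun y => Z < y); split; [now exists Z|]; intros u v Hu Hv.
  change (Rabs (Phi v - Phi u) < e).
  generalize (cond_pos e) (HK (- Z) u ltac:(lra) ltac:(lra))
    (HK (- Z) v ltac:(lra) ltac:(lra)).
  unfold Rabs; repeat destruct Rcase_abs; lra. }
assert (Lp : forall e, 0 < e -> exists Z, forall z, Z <= z -> Rabs (Phi z - gp) <= e).
{ intros e He.
  destruct (Hgp (fun v => Rabs (v - gp) < e)) as [M HM].
  { exists (mkposreal e He); intros v Hv; exact Hv. }
  exists (M + 1); intros z Hz; apply Rlt_le, HM; lra. }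
assert (Lm : forall e, 0 < e -> exists Z, forall z, z <= Z -> Rabs (Phi z + (gamma - gp)) <= e).
{ intros e He.
  destruct (Lp (e / 2)) as [Z HZ]; [lra|].
  destruct (K (e / 2)) as [Z' [_ HZ']]; [lra|].
  exists (- Z'); intros z Hz.
  generalize (HZ (Rmax Z Z') (Rmax_l _ _)) (HZ' z (Rmax Z Z') Hz (Rmax_r _ _)).
  unfold Rabs; repeat destruct Rcase_abs; lra. }
assert (Hub : forall z, Phi z <= gp).
{ intros z; apply le_epsilon; intros e He; destruct (Lp e He) as [Z HZ].
  generalize (HZ (Rmax Z z) (Rmax_l _ _)) (Hmono z (Rmax Z z) (Rmax_r _ _)).
  unfold Rabs; destruct Rcase_abs; lra. }
assert (Hlb : forall z, - (gamma - gp) <= Phi z).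
{ intros z; apply le_epsilon; intros e He; destruct (Lm e He) as [Z HZ].
  generalize (HZ (Rmin Z z) (Rmin_l _ _)) (Hmono (Rmin Z z) z (Rmin_r _ _)).
  unfold Rabs; destruct Rcase_abs; lra. }
exists gp, (gamma - gp); repeat split; auto.
- rewrite <- Phi0; apply Hub.
- generalize (Hlb 0); lra.
- ring.
Qed.

(** With [eps = / |z|] and [x] the sign of [z], [rescaled c eps x] is exactly [|z| c z]; large |z|
    corresponds to small eps. *)
Lemma potential_tail :
  (forall x, x <> 0 -> filterlim (fun eps => rescaled c eps x) (at_right 0) (locally 0)) ->
  forall e, 0 < e -> exists Z, 0 < Z /\ forall z, Z <= Rabs z -> Rabs z * c z <= e.
Proof.
intros c_lim e He.
assert (K : forall x, x <> 0 -> exists d, 0 < d /\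
  forall eps, 0 < eps < d -> rescaled c eps x <= e).
{ intros x Hx.
  destruct (c_lim x Hx (fun v => Rabs (v - 0) < e)) as [d Hd].
  { exists (mkposreal e He); intros v Hv; exact Hv. }
  exists d; split; [apply cond_pos|]; intros eps Heps.
  assert (H : Rabs (rescaled c eps x - 0) < e).
  { apply Hd; [|lra]; change (Rabs (eps - 0) < d); rewrite Rabs_pos_eq; lra. }
  revert H; unfold Rabs; destruct Rcase_abs; lra. }
destruct (K 1) as [d [Hd H1]]; [lra|].
destruct (K (-1)) as [d' [Hd' H2]]; [lra|].
exists (/ d + / d' + 1).
assert (I1 : 0 < / d) by now apply Rinv_0_lt_compat.
assert (I2 : 0 < / d') by now apply Rinv_0_lt_compat.
split; [lra|]; intros z Hz.
assert (Hz0 : 0 < / Rabs z) by (apply Rinv_0_lt_compat; lra).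
assert (Hzd : / Rabs z < d).
{ rewrite <- (Rinv_inv d); apply Rinv_0_lt_contravar; lra. }
assert (Hzd' : / Rabs z < d').
{ rewrite <- (Rinv_inv d'); apply Rinv_0_lt_contravar; lra. }
destruct (Rle_lt_dec 0 z) as [Hs|Hs].
- generalize (H1 (/ Rabs z) ltac:(lra)); unfold rescaled; rewrite Rinv_inv.
  rewrite (Rabs_pos_eq z Hs), Rmult_1_r; auto.
- generalize (H2 (/ Rabs z) ltac:(lra)); unfold rescaled; rewrite Rinv_inv.
  rewrite (Rabs_left z Hs); replace (- z * -1) with z by ring; auto.
Qed.

Lemma continuous_moment x : continuous (fun z => Rabs z * c z) x.
Proof.
apply (continuous_mult (K := R_AbsRing)); [|apply c_cont].
apply (filterlim_norm (K := R_AbsRing) (V := R_NormedModule)).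
Qed.

(* [u = W + E] where [W] solves the equation with [c_eps W] replaced by [c_eps w0] and
   [E] is one Picard correction; [l] restores [u'' = 0] at the ends.  Since
   [W - w0 = O(x)] and [x c_eps(x)] is bounded, the remainder [c_eps E] is small. *)
Lemma A_eps_approximant (a b eps w0 s B Cw tau : R) (k K1 K2 Phi Psi N : R -> R) :
  a < 0 < b -> 0 < eps -> 0 <= Cw -> 0 <= tau ->
  (forall x, continuous k x) -> k a = 0 -> k b = 0 ->
  (forall x, is_derive K1 x (k x)) -> (forall x, is_derive K2 x (K1 x)) ->
  (forall x, is_derive Phi x (c x)) -> (forall x, is_derive Psi x (Phi x)) ->
  (forall x, is_derive N x (Rabs x * c x)) -> N 0 = 0 ->
  (forall z, Rabs z * c z <= B) ->
  (forall x, Icc a b x ->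
     Rabs (s * x + K2 x + 2 * w0 * (eps * Psi (/ eps * x))) <= Cw * Rabs x) ->
  (forall x, Icc a b x -> Rabs (eps * N (/ eps * x)) <= tau) ->
  rescaled c eps a <= tau -> rescaled c eps b <= tau ->
  let L := 4 * tau * (Rabs w0 + Cw * (b - a)) in
  let theta := 2 * Cw * tau + L * (b - a) in
  exists u v : Cont a b, A_eps a b c eps u v /\
    (forall x, Icc a b x ->
       Rabs (u x - (w0 + s * x + K2 x + 2 * w0 * (eps * Psi (/ eps * x))))
         <= theta * (b - a)) /\
    (forall x, Icc a b x -> Rabs (v x - / 2 * k x) <= L + theta * B).
Proof.
intros Hab Heps HCw Htau Hk ka kb HK1 HK2 HPhi HPsi HN N0 HB HW HNt Hca Hcb L theta.
set (ce := rescaled c eps) in *.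
assert (Hi : 0 < / eps) by now apply Rinv_0_lt_compat.
assert (ce_ge0 : forall x, 0 <= ce x).
{ intros x; unfold ce, rescaled; apply Rmult_le_pos; [lra|apply c_ge0]. }
assert (ce_cont : forall x, continuous ce x).
{ intros x; apply (continuous_scal_r (V := R_NormedModule) (/ eps) (fun x => c (/ eps * x))).
  apply (continuous_comp (fun x => / eps * x) c); [|apply c_cont].
  apply (continuous_scal_r (V := R_NormedModule) (/ eps) (fun x => x)), continuous_id. }
set (D := fun x => s * x + K2 x + 2 * w0 * (eps * Psi (/ eps * x))).
change (forall x, Icc a b x -> Rabs (D x) <= Cw * Rabs x) in HW.
set (D1 := fun x => s + K1 x + 2 * w0 * Phi (/ eps * x)).
assert (HD : forall x, is_derive D x (D1 x)).
{ intros x; unfold D, D1.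
  apply (is_derive_plus (V := R_NormedModule)).
  - apply (is_derive_plus (V := R_NormedModule)); [|apply HK2].
    auto_derive; [exact I|ring].
  - apply (is_derive_scal (fun x => eps * Psi (/ eps * x)) x (2 * w0)).
    apply is_derive_rescale_unit; [lra|exact HPsi]. }
assert (HD1 : forall x, is_derive D1 x (k x + 2 * w0 * ce x)).
{ intros x; unfold D1.
  apply (is_derive_plus (V := R_NormedModule)).
  - rewrite <- (Rplus_0_l (k x)).
    apply (is_derive_plus (V := R_NormedModule) (fun _ => s)); [|apply HK1].
    apply (is_derive_const (V := R_NormedModule)).
  - apply (is_derive_scal (fun x => Phi (/ eps * x)) x (2 * w0)).
    now apply is_derive_rescale. }
assert (D_cont : forall x, continuous D x) by (intros; eapply is_derive_continuous; apply HD).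
(* As [k] vanishes at the ends, the second derivative of the corrected function there is
   [2 ce (w0 + D)] minus [l]. So [l] interpolates these two end values, which are small because
   [ce <= tau] at [a] and [b]. *)
set (la := 2 * ce a * (w0 + D a)); set (lb := 2 * ce b * (w0 + D b)).
set (l := fun x => la + (lb - la) / (b - a) * (x - a)).
assert (Habs : forall x, Icc a b x -> Rabs x <= b - a).
{ intros x Hx; unfold Icc in Hx; apply Rabs_le; lra. }
assert (HL : 0 <= L).
{ unfold L; generalize (Rabs_pos w0); intros.
  apply Rmult_le_pos; [lra|]; nra. }
assert (Hend : forall x, Icc a b x -> ce x <= tau -> Rabs (2 * ce x * (w0 + D x)) <= L / 2).
{ intros x Hx Hc.
  assert (Rabs (w0 + D x) <= Rabs w0 + Cw * (b - a)).
  { apply Rle_trans with (1 := Rabs_triang _ _).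
    generalize (HW x Hx) (Habs x Hx); nra. }
  rewrite Rabs_mult, (Rabs_pos_eq (2 * ce x)) by (generalize (ce_ge0 x); lra).
  unfold L; generalize (ce_ge0 x) (Rabs_pos (w0 + D x)); nra. }
assert (Hla : Rabs la <= L / 2) by (apply Hend; [unfold Icc; lra|exact Hca]).
assert (Hlb : Rabs lb <= L / 2) by (apply Hend; [unfold Icc; lra|exact Hcb]).
assert (Hl : forall x, Icc a b x -> Rabs (l x) <= L).
{ intros x Hx.
  assert (Hr : 0 <= (x - a) / (b - a) <= 1).
  { unfold Icc in Hx; split; [apply Rdiv_le_0_compat; lra|].
    apply Rmult_le_reg_r with (b - a); [lra|].
    unfold Rdiv; rewrite Rmult_assoc, Rinv_l; lra. }
  apply Rabs_le_between in Hla; apply Rabs_le_between in Hlb.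
  replace (l x) with (la + (lb - la) * ((x - a) / (b - a))) by (unfold l; field; lra).
  apply Rabs_le; nra. }
set (E2 := fun x => 2 * ce x * D x - l x).
assert (HE2 : forall x, continuous E2 x).
{ intros x; unfold E2, l.
  apply (continuous_minus (V := R_NormedModule)).
  - apply (continuous_mult (K := R_AbsRing)); [|apply D_cont].
    apply (continuous_scal_r (V := R_NormedModule) 2), ce_cont.
  - apply (is_derive_continuous _ x ((lb - la) / (b - a))); auto_derive; [exact I|ring]. }
destruct (primitive_exists E2 HE2) as [E1 [E10 HE1]].
destruct (primitive_exists E1) as [E [E0 HE]].
{ intros x; eapply is_derive_continuous; apply HE1. }
(* [2 |ce D|] is at most [2 Cw |x| ce], whose primitive [2 Cw eps N (x / eps)] is at most
   [2 Cw tau]; the part [l] adds at most [L (b - a)]. The sum is [theta]. *)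
assert (E1b : forall x, Icc a b x -> Rabs (E1 x) <= theta).
{ intros x Hx.
  pose (G := fun x => 2 * Cw * (eps * N (/ eps * x)) + L * x).
  assert (HG : forall x, is_derive G x (2 * Cw * (Rabs (/ eps * x) * c (/ eps * x)) + L)).
  { intros y; unfold G; apply (is_derive_plus (V := R_NormedModule)).
    - apply (is_derive_scal (fun x => eps * N (/ eps * x)) y (2 * Cw)).
      apply (is_derive_rescale_unit N (fun z => Rabs z * c z)); [lra|exact HN].
    - auto_derive; [exact I|ring]. }
  apply Rle_trans with (Rabs (G x)).
  - apply (primitive_domination E1 E2 G _ a b x HE1 HG); auto; [|lra|].
    + unfold G; rewrite !Rmult_0_r, N0; ring.
    + intros y Hy; unfold E2, Rminus.
      apply Rle_trans with (1 := Rabs_triang _ _); rewrite Rabs_Ropp.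
      apply Rplus_le_compat; [|now apply Hl].
      rewrite Rabs_mult, (Rabs_pos_eq (2 * ce y)) by (generalize (ce_ge0 y); lra).
      rewrite Rabs_mult, (Rabs_pos_eq (/ eps)) by lra.
      replace (2 * Cw * (/ eps * Rabs y * c (/ eps * y))) with (2 * ce y * (Cw * Rabs y))
        by (unfold ce, rescaled; ring).
      apply Rmult_le_compat_l; [generalize (ce_ge0 y); lra|now apply HW].
  - unfold G, theta.
    apply Rle_trans with (1 := Rabs_triang _ _).
    rewrite (Rabs_mult (2 * Cw)), (Rabs_mult L), (Rabs_pos_eq (2 * Cw)), (Rabs_pos_eq L) by lra.
    apply Rplus_le_compat; apply Rmult_le_compat_l; auto; lra. }
assert (Hth : 0 <= theta).
{ apply Rle_trans with (2 := E1b 0 ltac:(unfold Icc; lra)); apply Rabs_pos. }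
assert (Eb : forall x, Icc a b x -> Rabs (E x) <= theta * Rabs x).
{ intros x Hx; apply (primitive_linear_bound E E1 theta a b); auto; lra. }
set (U := fun x => w0 + D x + E x).
assert (HU : forall x, is_derive U x (D1 x + E1 x)).
{ intros x; unfold U; apply (is_derive_plus (V := R_NormedModule)); [|apply HE].
  rewrite <- (Rplus_0_l (D1 x)).
  apply (is_derive_plus (V := R_NormedModule) (fun _ => w0)); [|apply HD].
  apply (is_derive_const (V := R_NormedModule)). }
assert (HU1 : forall x, is_derive (fun x => D1 x + E1 x) x (k x + 2 * w0 * ce x + E2 x)).
{ intros x; apply (is_derive_plus (V := R_NormedModule)); [apply HD1|apply HE1]. }
assert (U_cont : forall x, continuous U x) by (intros; eapply is_derive_continuous; apply HU).
assert (U2_cont : forall x, continuous (fun x => k x + 2 * w0 * ce x + E2 x) x).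
{ intros x; apply (continuous_plus (V := R_NormedModule)); [|apply HE2].
  apply (continuous_plus (V := R_NormedModule)); [apply Hk|].
  apply (continuous_scal_r (V := R_NormedModule) (2 * w0)), ce_cont. }
destruct (Cont_of_continuous (a := a) (b := b) U U_cont) as [u Hu].
destruct (Cont_of_continuous (a := a) (b := b)
  (fun x => / 2 * (k x + 2 * w0 * ce x + E2 x) - ce x * U x)) as [v Hv].
{ intros x; apply (continuous_minus (V := R_NormedModule)).
  - apply (continuous_scal_r (V := R_NormedModule) (/ 2)), U2_cont.
  - apply (continuous_mult (K := R_AbsRing)); auto. }
exists u, v; split; [|split].
- exists (fun x => D1 x + E1 x), (fun x => k x + 2 * w0 * ce x + E2 x).
  split; [now apply C2_on_intro with U|].
  split; [rewrite ka; unfold E2, l, la; ring|].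
  split; [rewrite kb; unfold E2, l, lb; field; lra|].
  intros x Hx; rewrite Hv, Hu by exact Hx; reflexivity.
- intros x Hx; rewrite Hu by exact Hx.
  replace (U x - _) with (E x) by (unfold U, D; ring).
  apply Rle_trans with (1 := Eb x Hx), Rmult_le_compat_l; auto.
- intros x Hx; rewrite Hv by exact Hx.
  (* In [U'' / 2 - ce U] the terms with [w0] and [D] cancel; besides [k / 2] only [- l / 2 - ce E]
     remains. *)
  replace (_ - / 2 * k x) with (- / 2 * l x - ce x * E x) by (unfold U, E2; field).
  assert (X : ce x * Rabs (E x) <= theta * B).
  { apply Rle_trans with (ce x * (theta * Rabs x)).
    - apply Rmult_le_compat_l; auto.
    - replace (ce x * (theta * Rabs x)) with (theta * (Rabs (/ eps * x) * c (/ eps * x))).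
      + now apply Rmult_le_compat_l.
      + rewrite Rabs_mult, (Rabs_pos_eq (/ eps)) by lra; unfold ce, rescaled; ring. }
  unfold Rminus; apply Rle_trans with (1 := Rabs_triang _ _).
  rewrite Rabs_Ropp, !Rabs_mult, (Rabs_pos_eq (ce x)) by auto.
  rewrite Rabs_Ropp, (Rabs_pos_eq (/ 2)) by lra.
  generalize (Hl x Hx); lra.
Qed.

End Potential.

(** * Structure of the limit domain and choice of parameters *)

Lemma D_in_zero_constant p q f f1 x y :
  (forall z, Icc p q z -> D_in f f1 (Icc p q) z) -> (forall z, Icc p q z -> f1 z = 0) ->
  Icc p q x -> Icc p q y -> f x = f y.
Proof.
intros HD H0 Hx Hy; unfold Icc in Hx, Hy.
destruct (Rtotal_order x y) as [Hlt|[->|Hgt]]; [|reflexivity|].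
- destruct (D_in_MVT p q f f1 x y HD) as [z [Hz E]]; try lra.
  rewrite H0 in E by (unfold Icc; lra); lra.
- destruct (D_in_MVT p q f f1 y x HD) as [z [Hz E]]; try lra.
  rewrite H0 in E by (unfold Icc; lra); lra.
Qed.

Lemma C2_on_determined p q f f1 f2 F F1 F2 x0 x : C2_on p q f f1 f2 -> C2_on p q F F1 F2 ->
  (forall z, Icc p q z -> f2 z = F2 z) -> Icc p q x0 -> f x0 = F x0 -> f1 x0 = F1 x0 ->
  Icc p q x -> f x = F x.
Proof.
intros Hf HF E Hx0 E0 E1 Hx.
destruct (C2_on_plus _ _ _ _ _ _ _ _ Hf (C2_on_scal _ _ (-1) _ _ _ HF)) as [H1 [H2 _]].
assert (K : f x + -1 * F x = f x0 + -1 * F x0).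
{ apply (D_in_zero_constant p q (fun x => f x + -1 * F x) _ x x0 H1); auto.
  intros z Hz.
  assert (K1 : f1 z + -1 * F1 z = f1 x0 + -1 * F1 x0).
  { apply (D_in_zero_constant p q (fun x => f1 x + -1 * F1 x) _ z x0 H2); auto.
    intros y Hy; rewrite E by exact Hy; ring. }
  lra. }
lra.
Qed.

(** The one-sided second derivatives agree at 0, so the continuous function [k = 2 g] serves on both
    sides and the two branches share [K2], differing only in slope. The witness [s] is the left
    derivative at 0. *)
Lemma A_lim_representation (a b gamma : R) (f g : Cont a b) (k K1 K2 : R -> R) : a < 0 < b ->
  A_lim a b gamma f g -> (forall x, continuous k x) -> (forall x, Icc a b x -> k x = 2 * g x) ->
  (forall x, is_derive K1 x (k x)) -> (forall x, is_derive K2 x (K1 x)) ->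
  K1 0 = 0 -> K2 0 = 0 ->
  k a = 0 /\ k b = 0 /\ exists s,
    (forall x, Icc a 0 x -> f x = f 0 + s * x + K2 x) /\
    (forall x, Icc 0 b x -> f x = f 0 + (s + 2 * gamma * f 0) * x + K2 x).
Proof.
intros Hab [l1 [l2 [r1 [r2 [H1 [H2 [H3 [H4 [H5 [H6 [H7 H8]]]]]]]]]]] Hk Ek HK1 HK2 K10 K20.
split; [rewrite Ek, H7, H3 by (unfold Icc; lra); lra|].
split; [rewrite Ek, H8, H4 by (unfold Icc; lra); lra|].
assert (HC : forall p q s, C2_on p q (fun x => f 0 + s * x + K2 x) (fun x => s + K1 x) k).
{ intros p q s; apply C2_on_intro with (fun x => f 0 + s * x + K2 x); auto.
  - intros x; apply (is_derive_plus (V := R_NormedModule)); [|apply HK2].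
    auto_derive; [exact I|ring].
  - intros x; rewrite <- (Rplus_0_l (k x)).
    apply (is_derive_plus (V := R_NormedModule) (fun _ => s)); [|apply HK1].
    apply (is_derive_const (V := R_NormedModule)). }
exists (l1 0); split; intros x Hx.
- apply (C2_on_determined a 0 f l1 l2 _ _ _ 0 x H1 (HC a 0 (l1 0))); auto.
  + intros z Hz; rewrite Ek, H7 by (unfold Icc in *; lra); lra.
  + unfold Icc; lra.
  + rewrite K20; ring.
  + rewrite K10; ring.
- apply (C2_on_determined 0 b f r1 r2 _ _ _ 0 x H2 (HC 0 b (l1 0 + 2 * gamma * f 0))); auto.
  + intros z Hz; rewrite Ek, H8 by (unfold Icc in *; lra); lra.
  + unfold Icc; lra.
  + rewrite K20; ring.
  + rewrite K10; lra.
Qed.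

Lemma moment_bounded (c : R -> R) : (forall x, 0 <= c x) -> (forall x, continuous c x) ->
  (forall e, 0 < e -> exists Z, 0 < Z /\ forall z, Z <= Rabs z -> Rabs z * c z <= e) ->
  exists B, 0 <= B /\ forall z, Rabs z * c z <= B.
Proof.
intros c_ge0 c_cont Htail.
destruct (Htail 1 Rlt_0_1) as [Z [HZ Ht]].
destruct (continuous_bounded (fun z => Rabs z * c z) (- Z) Z) as [M [HM HMb]];
  [lra|apply continuous_moment; exact c_cont|].
exists (M + 1); split; [lra|]; intros z.
destruct (Rle_lt_dec Z (Rabs z)) as [Hz|Hz].
- generalize (Ht z Hz); lra.
- assert (Hz' : Icc (- Z) Z z) by (apply Rabs_def2 in Hz; unfold Icc; lra).
  generalize (HMb z Hz') (Rle_abs (Rabs z * c z)); lra.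
Qed.

Lemma two_sided_sublinear (F : R -> R) e :
  (exists C, forall z, 0 <= z -> Rabs (F z) <= C + e * z) ->
  (exists C, forall z, z <= 0 -> Rabs (F z) <= C + e * - z) ->
  exists C, forall z, Rabs (F z) <= C + e * Rabs z.
Proof.
intros [C HC] [C' HC']; exists (Rmax C C'); intros z.
generalize (Rmax_l C C') (Rmax_r C C'); intros.
destruct (Rle_lt_dec 0 z) as [Hz|Hz].
- rewrite (Rabs_pos_eq z Hz); generalize (HC z Hz); lra.
- rewrite (Rabs_left z Hz); generalize (HC' z ltac:(lra)); lra.
Qed.

Lemma A_eps_extended_limit (a b : R) (c : R -> R) (gamma : R) : a < 0 < b ->
  (forall x, 0 <= c x) -> (forall x, continuous c x) ->
  is_RInt_gen c (Rbar_locally m_infty) (Rbar_locally p_infty) gamma ->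
  (forall x, x <> 0 -> filterlim (fun eps => rescaled c eps x) (at_right 0) (locally 0)) ->
  extended_limit (A_lim a b gamma) (A_eps a b c).
Proof.
intros Hab c_ge0 c_cont c_int c_lim f g Hfg d Hd.
destruct (primitive_exists c c_cont) as [Phi [Phi0 HPhi]].
destruct (primitive_exists Phi) as [Psi [Psi0 HPsi]].
{ intros x; eapply is_derive_continuous; apply HPhi. }
destruct (primitive_exists (fun z => Rabs z * c z) (continuous_moment c c_cont))
  as [N [N0 HN]].
assert (Htail := potential_tail c c_lim).
destruct (moment_bounded c c_ge0 c_cont Htail) as [B [HB0 HB]].
destruct (total_integral_split c gamma c_ge0 c_cont Phi c_int HPhi Phi0)
  as [gp [gm [Hgp [Hgm [Egam [HPhib [Lp Lm]]]]]]].
destruct (Cont_extension g) as [G [HG [EG _]]]; [lra|].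
set (k := fun x => 2 * G x).
assert (Hk : forall x, continuous k x).
{ intros x; apply (continuous_scal_r (V := R_NormedModule) 2), HG. }
destruct (primitive_exists k Hk) as [K1 [K10 HK1]].
destruct (primitive_exists K1) as [K2 [K20 HK2]].
{ intros x; eapply is_derive_continuous; apply HK1. }
destruct (A_lim_representation a b gamma f g k K1 K2) as [ka [kb [s [El Er]]]]; auto.
{ intros x Hx; unfold k; now rewrite EG. }
set (w0 := f 0) in *.
(* [eps Psi (x / eps)] tends to [gp x] for [x > 0] and to [- gm x] for [x < 0]. With the slope [s']
   the limiting slopes are [s + 2 gamma w0] on the right and [s] on the left, as required. *)
set (s' := s + 2 * w0 * gm).
assert (HI0 : Icc a b 0) by (unfold Icc; lra).
(* The distance of [Psi] from its asymptotic slopes; it grows sublinearly since [Phi] tends to [gp]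
   and [- gm]. *)
pose (Hkap := fun z => Psi z - (if Rle_dec 0 z then gp * z else - gm * z)).
assert (Hsub : forall e, 0 < e -> exists C, forall z, Rabs (Hkap z) <= C + e * Rabs z).
{ intros e He; apply two_sided_sublinear.
  - destruct (primitive_sublinear (fun z => Psi z - gp * z) (fun z => Phi z - gp)) with e
      as [C HC]; auto.
    { intros x; apply (is_derive_minus (V := R_NormedModule)); [apply HPsi|].
      auto_derive; [exact I|ring]. }
    exists C; intros z Hz; unfold Hkap; destruct Rle_dec; [auto|lra].
  - destruct (primitive_sublinear_neg (fun z => Psi z + gm * z) (fun z => Phi z + gm)) with e
      as [C HC]; auto.
    { intros x; apply (is_derive_plus (V := R_NormedModule)); [apply HPsi|].
      auto_derive; [exact I|ring]. }
    exists C; intros z Hz; unfold Hkap; destruct Rle_dec as [Hz'|Hz'].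
    + replace z with 0 by lra; replace (Psi 0 - gp * 0) with (Psi 0 + gm * 0) by ring.
      apply HC; lra.
    + replace (Psi z - - gm * z) with (Psi z + gm * z) by ring; now apply HC. }
assert (HsubN : forall e, 0 < e -> exists C, forall z, Rabs (N z) <= C + e * Rabs z).
{ assert (Habs : forall z, Rabs (Rabs z * c z) = Rabs z * c z).
  { intros z; apply Rabs_pos_eq, Rmult_le_pos; [apply Rabs_pos|apply c_ge0]. }
  intros e He; apply two_sided_sublinear.
  - apply (primitive_sublinear N _ HN); [|exact He]; intros e' He'.
    destruct (Htail e' He') as [Z [HZ HZt]]; exists Z; intros z Hz.
    rewrite Habs; apply HZt; rewrite Rabs_pos_eq; lra.
  - apply (primitive_sublinear_neg N _ HN); [|exact He]; intros e' He'.
    destruct (Htail e' He') as [Z [HZ HZt]]; exists (- Z); intros z Hz.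
    rewrite Habs; apply HZt; rewrite Rabs_left; lra. }
destruct (continuous_bounded K1 a b) as [MK [HMK HMKb]]; [lra| |].
{ intros x; eapply is_derive_continuous; apply HK1. }
(* A bound on the derivative [s' + K1 + 2 w0 Phi (x / eps)], uniform in eps because |Phi| is at most
   [gamma]. *)
set (Cw := Rabs s' + MK + 2 * Rabs w0 * gamma).
assert (HCw : 0 <= Cw).
{ unfold Cw; generalize (Rabs_pos s') (Rabs_pos w0); nra. }
set (W := b - a).
(* All errors are proportional to [tau]; [H] is the sum of their coefficients, so [tau = d / H]
   makes the total equal to [d] (see [EL]). *)
set (H := (4 * (Rabs w0 + Cw * W)) * (1 + W * (W + B)) + 2 * Cw * (W + B) + 2 * Rabs w0 + 1).
assert (HW : 0 < W) by (unfold W; lra).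
assert (Hw0 := Rabs_pos w0).
assert (HCwW : 0 <= Cw * W) by nra.
assert (HCwB : 0 <= Cw * (W + B)) by nra.
assert (HH : 0 < H).
{ unfold H.
  assert (0 <= (4 * (Rabs w0 + Cw * W)) * (1 + W * (W + B))) by (apply Rmult_le_pos; nra).
  lra. }
set (tau := d / H).
assert (Htau : 0 < tau) by now apply Rdiv_lt_0_compat.
assert (EH : tau * H = d) by (unfold tau; field; lra).
assert (Hce : forall x, x <> 0 -> at_right 0 (fun eps => rescaled c eps x <= tau)).
{ intros x Hx.
  assert (P : locally 0 (fun v => v <= tau)).
  { exists (mkposreal tau Htau); intros v Hv.
    change (Rabs (v - 0) < tau) in Hv; revert Hv; unfold Rabs; destruct Rcase_abs; lra. }
  exact (c_lim x Hx _ P). }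
assert (Hall := filter_and (F := at_right 0) _ _
  (filter_and (F := at_right 0) _ _ at_right_0_unit
    (filter_and (F := at_right 0) _ _ (Hce a ltac:(lra)) (Hce b ltac:(lra))))
  (filter_and (F := at_right 0) _ _ (rescaled_sublinear_small a b Hkap Hab Hsub tau Htau)
    (rescaled_sublinear_small a b N Hab HsubN tau Htau))).
revert Hall; apply filter_imp.
intros eps [[[Heps _] [Hca Hcb]] [Hkt HNt]].
assert (Hi : 0 < / eps) by now apply Rinv_0_lt_compat.
assert (Hlin : forall x, Icc a b x ->
  Rabs (s' * x + K2 x + 2 * w0 * (eps * Psi (/ eps * x))) <= Cw * Rabs x).
{ intros x Hx.
  apply (primitive_linear_bound (fun x => s' * x + K2 x + 2 * w0 * (eps * Psi (/ eps * x)))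
    (fun x => s' + K1 x + 2 * w0 * Phi (/ eps * x)) Cw a b); auto.
  - intros y; apply (is_derive_plus (V := R_NormedModule)).
    + apply (is_derive_plus (V := R_NormedModule)); [|apply HK2].
      auto_derive; [exact I|ring].
    + apply (is_derive_scal (fun x => eps * Psi (/ eps * x)) y (2 * w0)).
      apply is_derive_rescale_unit; [lra|exact HPsi].
  - rewrite !Rmult_0_r, K20, Psi0; ring.
  - intros y Hy; unfold Cw.
    apply Rle_trans with (1 := Rabs_triang _ _), Rplus_le_compat.
    + apply Rle_trans with (1 := Rabs_triang _ _), Rplus_le_compat; [lra|now apply HMKb].
    + rewrite !Rabs_mult, (Rabs_pos_eq 2) by lra.
      apply Rmult_le_compat_l; [lra|]; apply Rabs_le; generalize (HPhib (/ eps * y)); lra. }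
destruct (A_eps_approximant c c_ge0 c_cont a b eps w0 s' B Cw tau k K1 K2 Phi Psi N)
  as [u [v [Huv [Hu Hv]]]]; auto; [lra|].
exists u, v; split; [exact Huv|].
set (L := 4 * tau * (Rabs w0 + Cw * (b - a))) in *.
set (theta := 2 * Cw * tau + L * (b - a)) in *.
assert (EL : L + theta * B + theta * W + 2 * Rabs w0 * tau + tau = d).
{ rewrite <- EH; unfold theta, L, H; fold W; ring. }
assert (HL : 0 <= L) by (unfold L; fold W; apply Rmult_le_pos; lra).
assert (Hth : 0 <= theta) by (unfold theta; fold W; nra).
assert (HthB : 0 <= theta * B) by nra.
assert (HthW : 0 <= theta * W) by nra.
assert (Hwt : 0 <= Rabs w0 * tau) by nra.
split; apply norm_le_intro; try lra; intros x Hx; pointwise.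
- assert (Ef : f x = w0 + s' * x + K2 x + 2 * w0 * (eps * Psi (/ eps * x))
    - 2 * w0 * (eps * Hkap (/ eps * x))).
  { unfold Hkap, s'; destruct Rle_dec as [Hz|Hz].
    - assert (Hx0 : 0 <= x).
      { apply Rmult_le_reg_l with (/ eps); [exact Hi|]; lra. }
      rewrite Er, Egam by (unfold Icc in *; lra); fold w0; field; lra.
    - assert (Hx0 : x <= 0).
      { apply Rnot_lt_le; intros Hlt; apply Hz; nra. }
      rewrite El by (unfold Icc in *; lra); fold w0; field; lra. }
  specialize (Hu x Hx); specialize (Hkt x Hx); fold W in Hu.
  apply Rabs_le_between in Hu.
  assert (X : Rabs (w0 * (eps * Hkap (/ eps * x))) <= Rabs w0 * tau).
  { rewrite Rabs_mult; now apply Rmult_le_compat_l. }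
  apply Rabs_le_between in X; lra.
- specialize (Hv x Hx); apply Rabs_le_between in Hv.
  unfold k in Hv; rewrite EG in Hv by exact Hx; lra.
Qed.

Theorem theorem1p1 (a b : R) (c : R -> R) (gamma : R)
  (a_lt0 : a < 0) (b_gt0 : 0 < b)
  (c_ge0 : forall x, 0 <= c x)
  (c_cont : forall x, continuous c x)
  (c_int : is_RInt_gen c (Rbar_locally m_infty) (Rbar_locally p_infty) gamma)
  (c_lim : forall x, x <> 0 ->
     filterlim (fun eps => rescaled c eps x) (at_right 0) (locally 0)) :
  Feller_generator (A_lim a b gamma) /\
  forall (Teps : R -> R -> Cont a b -> Cont a b) (T : R -> Cont a b -> Cont a b),
    (forall eps, 0 < eps <= 1 ->
       Feller_semigroup (Teps eps) /\ generates (A_eps a b c eps) (Teps eps)) ->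
    Feller_semigroup T -> generates (A_lim a b gamma) T ->
    (forall t (f : Cont a b), 0 <= t ->
       filterlim (fun eps => Teps eps t f) (at_right 0) (locally (T t f))) /\
    (forall (t0 : R) (f : Cont a b) (delta : posreal),
       at_right 0 (fun eps => forall t, 0 <= t <= t0 ->
         norm (minus (Teps eps t f) (T t f)) < delta)).
Proof.
(* The sign of [gamma] enters through the minimum principle at the kink and the solvability of the
   jump condition. *)
assert (Hgam : 0 <= gamma).
{ destruct (primitive_exists c c_cont) as [Phi [Phi0 HPhi]].
  destruct (total_integral_split c gamma c_ge0 c_cont Phi c_int HPhi Phi0)
    as [gp [gm [Hgp [Hgm [Egam _]]]]]; lra. }
assert (HA := A_lim_pregenerator a b gamma (conj a_lt0 b_gt0) Hgam).
split; [now apply Hille_Yosida_Ray|].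
intros Teps T Hgen HT HG.
assert (U : forall t0 f e, 0 < e -> at_right 0 (fun eps => forall t, 0 <= t <= t0 ->
  norm (minus (Teps eps t f) (T t f)) < e)).
{ intros t0 f e He.
  apply (Trotter_Kato _ HA (A_eps a b c)); auto.
  now apply A_eps_extended_limit. }
split.
- intros t f Ht P [e He].
  apply (filter_imp (F := at_right 0)) with (2 := U t f e (cond_pos e)); intros eps H.
  apply He, H; lra.
- intros t0 f delta; apply U, cond_pos.
Qed.
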